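(* Let $\beta\in\{1,2,4\}$, let $a\neq0$ and $b$ be real, and put $\kappa=\sqrt{|b^2-4a|}$. Consider on $U=\{(\sigma_1,\sigma_2)\in\mathbb R^2:4\sigma_2<\sigma_1^2\}$ the system $$g_{11}-\sigma_2g_{22}=\tfrac\beta2g_2+(b^2-4a)g,\qquad 2g_{12}+\sigma_1g_{22}=0,$$ for functions $g$ that extend by continuity to $\sigma_1=\sigma_2=0$, with initial conditions $g(0,0)=1$ and $\frac{\partial g(\sigma_1,0)}{\partial\sigma_1}\big|_{\sigma_1=0}=-b$. \begin{enumerate} \item[(i)] If $b^2=4a>0$, all solutions are $g(\sigma_1,\sigma_2)=1-b\sigma_1+C(\beta\sigma_1^2+4\sigma_2)$, where $C$ is an arbitrary real constant. Accordingly, $$L(\theta)=\frac{\exp(-\sigma_1(\theta)/b)}{\big(1-b\sigma_1(\theta)+C(\beta\sigma_1^2(\theta)+4\sigma_2(\theta))\big)^{1/b^2}}.$$ \item[(ii)] If $b^2>4a$, all solutions are $g(\sigma_1,\sigma_2)=C_1e^{\kappa\sigma_1}+C_2e^{-\kappa\sigma_1}+C_3\,\mathcal I_{(\beta-1)/2}\big(\kappa\sqrt{\sigma_1^2-4\sigma_2}\big)$, where $C_1,C_2,C_3$ are arbitrary real numbers with $C_1+C_2+C_3=1$ and $C_2-C_1=b/\kappa$. Accordingly, $$L(\theta)=e^{-b\sigma_1/(4a)}\Big(C_1e^{\kappa\sigma_1}+C_2e^{-\kappa\sigma_1}+C_3\,\mathcal I_{(\beta-1)/2}\big(\kappa\sqrt{\sigma_1^2-4\sigma_2}\big)\Big)^{-1/(4a)},$$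 which can also be written as $$L(\theta)=e^{-b\sigma_1/(4a)}\Big((1-\lambda)\cosh(\kappa\sigma_1)-\tfrac b\kappa\sinh(\kappa\sigma_1)+\lambda\,\mathcal I_{(\beta-1)/2}\big(\kappa\sqrt{\sigma_1^2-4\sigma_2}\big)\Big)^{-1/(4a)}$$ with an arbitrary constant $\lambda\in\mathbb R$. \item[(iii)] If $b^2<4a$, all solutions are $g(\sigma_1,\sigma_2)=(1-\lambda)\cos\kappa\sigma_1-\frac b\kappa\sin\kappa\sigma_1+\lambda\,\mathcal J_{(\beta-1)/2}\big(\kappa\sqrt{\sigma_1^2-4\sigma_2}\big)$, where $\lambda$ is an arbitrary real constant. Accordingly, $$L(\theta)=e^{-b\sigma_1/(4a)}\Big((1-\lambda)\cos\kappa\sigma_1-\tfrac b\kappa\sin\kappa\sigma_1+\lambda\,\mathcal J_{(\beta-1)/2}\big(\kappa\sqrt{\sigma_1^2-4\sigma_2}\big)\Big)^{-1/(4a)}.$$ \end{enumerate}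
   Context: $g_i=\partial g/\partial\sigma_i$, $g_{ij}=\partial^2g/\partial\sigma_i\partial\sigma_j$; solutions are (sufficiently smooth) functions on $U$. $\mathcal J_\nu(x)=\Gamma(\nu+1)(2/x)^\nu J_\nu(x)$ and $\mathcal I_\nu(x)=\Gamma(\nu+1)(2/x)^\nu I_\nu(x)$, where $J_\nu,I_\nu$ are the Bessel function of the first kind and the modified Bessel function of the first kind; they are entire functions with value $1$ at $0$. In the formulas for $L$: $\theta$ is a $2\times2$ real symmetric ($\beta=1$), complex Hermitian ($\beta=2$) or quaternionic Hermitian ($\beta=4$) matrix, $\sigma_1=\sigma_1(\theta)=\mathrm{tr}\,\theta$ and $\sigma_2=\sigma_2(\theta)=\det\theta$ (sum and product of the two real eigenvalues), and $L$ is the function obtained from $g$ through the relation $g(\sigma_1(\theta),\sigma_2(\theta))=\exp(-4a\ln L(\theta)-b\,\mathrm{tr}\,\theta)$, i.e. $L(\theta)=e^{-b\sigma_1/(4a)}\,g(\sigma_1,\sigma_2)^{-1/(4a)}$, where $g>0$. *)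

(* Defs.v *)
From HB Require Import structures.
From mathcomp Require Import all_boot all_order all_algebra.
From mathcomp Require Import all_classical all_reals all_analysis.
From mathcomp Require Import perm complex ring.
Set Implicit Arguments.
Unset Strict Implicit.
Unset Printing Implicit Defensive.
Import Order.TTheory GRing.Theory Num.Theory.
Import numFieldNormedType.Exports.
Local Open Scope classical_set_scope.
Local Open Scope ring_scope.

Record quaternion (R : Type) :=
  Quaternion { qre : R; qim_i : R; qim_j : R; qim_k : R }.

Section QuaternionRing.
Variable R : comNzRingType.
Local Notation H := (quaternion R).

Definition quat_code (x : H) : R * R * R * R :=
  (qre x, qim_i x, qim_j x, qim_k x).
Definition quat_decode (t : R * R * R * R) : H :=
  let: (a, b, c, d) := t in Quaternion a b c d.
Lemma quat_codeK : cancel quat_code quat_decode.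
Proof. by case. Qed.

HB.instance Definition _ := Choice.copy H (can_type quat_codeK).

Definition quat0 : H := Quaternion 0 0 0 0.
Definition quat1 : H := Quaternion 1 0 0 0.
Definition quat_opp (x : H) : H :=
  Quaternion (- qre x) (- qim_i x) (- qim_j x) (- qim_k x).
Definition quat_add (x y : H) : H :=
  Quaternion (qre x + qre y) (qim_i x + qim_i y)
             (qim_j x + qim_j y) (qim_k x + qim_k y).
Definition quat_mul (x y : H) : H :=
  let: Quaternion a1 b1 c1 d1 := x in
  let: Quaternion a2 b2 c2 d2 := y in
  Quaternion (a1 * a2 - b1 * b2 - c1 * c2 - d1 * d2)
             (a1 * b2 + b1 * a2 + c1 * d2 - d1 * c2)
             (a1 * c2 - b1 * d2 + c1 * a2 + d1 * b2)
             (a1 * d2 + b1 * c2 - c1 * b2 + d1 * a2).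
Definition quat_conj (x : H) : H :=
  Quaternion (qre x) (- qim_i x) (- qim_j x) (- qim_k x).

Fact quat_addA : associative quat_add.
Proof. by move=> [? ? ? ?] [? ? ? ?] [? ? ? ?]; rewrite /quat_add /= !addrA. Qed.
Fact quat_addC : commutative quat_add.
Proof. by move=> [? ? ? ?] [? ? ? ?]; congr Quaternion; rewrite /= addrC. Qed.
Fact quat_add0 : left_id quat0 quat_add.
Proof. by move=> [? ? ? ?]; rewrite /quat_add /= !add0r. Qed.
Fact quat_addN : left_inverse quat0 quat_opp quat_add.
Proof. by move=> [? ? ? ?]; rewrite /quat_add /= !addNr. Qed.
HB.instance Definition _ :=
  GRing.isZmodule.Build H quat_addA quat_addC quat_add0 quat_addN.

Fact quat_mulA : associative quat_mul.
Proof. by move=> [? ? ? ?] [? ? ? ?] [? ? ? ?]; congr Quaternion; ring. Qed.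
Fact quat_mul1 : left_id quat1 quat_mul.
Proof. by move=> [? ? ? ?]; congr Quaternion; ring. Qed.
Fact quat_mulr1 : right_id quat1 quat_mul.
Proof. by move=> [? ? ? ?]; congr Quaternion; ring. Qed.
Fact quat_mulDl : left_distributive quat_mul quat_add.
Proof. by move=> [? ? ? ?] [? ? ? ?] [? ? ? ?]; congr Quaternion; rewrite /=; ring. Qed.
Fact quat_mulDr : right_distributive quat_mul quat_add.
Proof. by move=> [? ? ? ?] [? ? ? ?] [? ? ? ?]; congr Quaternion; rewrite /=; ring. Qed.
Fact quat_1neq0 : quat1 != quat0.
Proof. by apply/eqP => -[] /eqP; rewrite oner_eq0. Qed.
HB.instance Definition _ := GRing.Zmodule_isNzRing.Build H
  quat_mulA quat_mul1 quat_mulr1 quat_mulDl quat_mulDr quat_1neq0.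

End QuaternionRing.

(* The coefficients: the reals for beta = 1, the complex numbers for beta = 2,
   the quaternions for beta = 4 (and, by totality, for any other beta). *)
Definition coefs (R : realType) (beta : nat) : nzRingType :=
  match beta with
  | 1 => R
  | 2 => R[i]
  | _ => quaternion R
  end.

Definition cconj (R : realType) (beta : nat) : coefs R beta -> coefs R beta :=
  match beta with
  | 1 => fun x => x
  | 2 => fun x => conjc x
  | _ => fun x => quat_conj x
  end.

Definition cre (R : realType) (beta : nat) : coefs R beta -> R :=
  match beta with
  | 1 => fun x => x
  | 2 => fun x => complex.Re x
  | _ => fun x => qre x
  end.

Definition creal (R : realType) (beta : nat) : R -> coefs R beta :=
  match beta with
  | 1 => fun x => x
  | 2 => fun x => Complex x 0
  | _ => fun x => Quaternion x 0 0 0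
  end.

Definition hermitian2 (R : realType) (beta : nat)
    (theta : 'M[coefs R beta]_2) : Prop :=
  forall i j, theta j i = cconj (theta i j).

(* The trace and determinant of a Hermitian matrix are real (tr_hermitian2 and
   det_hermitian2 below), so taking real parts loses nothing. Over the
   quaternions the Leibniz formula gives x y - q q^* on the Hermitian matrix
   with rows (x, q) and (q^*, y): this is its Moore determinant, the product of
   its two real eigenvalues. *)
Definition sigma (R : realType) (beta : nat) (theta : 'M[coefs R beta]_2)
  : R * R := (cre (\tr theta), cre (\det theta)).

Lemma det_mx2 (K : nzRingType) (A : 'M[K]_2) :
  \det A = A ord0 ord0 * A ord_max ord_max - A ord0 ord_max * A ord_max ord0.
Proof.
pose t : 'S_2 := tperm ord0 ord_max.
have ord2 (m : 'I_2) : m = ord0 \/ m = ord_max.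
  by case: m => [[|[|?]] ?] //; [left|right]; apply: val_inj.
have S2 (s : 'S_2) : s = 1%g \/ s = t.
  have inj_s := @perm_inj _ s ord0 ord_max.
  have [s0|s0] := ord2 (s ord0); have [s1|s1] := ord2 (s ord_max).
  - by have := inj_s (etrans s0 (esym s1)).
  - left; apply/permP => i; rewrite perm1.
    by have [->|->] := ord2 i.
  - right; apply/permP => i.
    by have [->|->] := ord2 i; rewrite ?tpermL ?tpermR.
  - by have := inj_s (etrans s0 (esym s1)).
have t1 : t != 1%g.
  by apply/eqP => /permP /(_ ord0); rewrite perm1 tpermL.
rewrite /determinant (bigD1 (1%g : 'S_2)) //= (bigD1 t) //=.
rewrite [X in _ + (_ + X)]big1 ?addr0; last first.
  by move=> s; have [->|->] := S2 s; rewrite eqxx ?andbF.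
rewrite odd_perm1 odd_tperm /= expr0 expr1 mul1r mulN1r.
rewrite !big_ord_recl !big_ord0 /= !mulr1 !perm1.
have -> : lift ord0 ord0 = ord_max :> 'I_2 by apply: val_inj.
by rewrite tpermL tpermR.
Qed.

Lemma tr_hermitian2 (R : realType) (beta : nat) (theta : 'M[coefs R beta]_2) :
  hermitian2 theta -> \tr theta = creal beta (sigma theta).1.
Proof.
rewrite /sigma /= /mxtrace !big_ord_recl big_ord0 addr0.
have -> : lift ord0 ord0 = ord_max :> 'I_2 by apply: val_inj.
move=> h; have := h ord0 ord0; have := h ord_max ord_max.
move: (theta ord0 ord0) (theta ord_max ord_max) {h} => x y.
have eqN (u : R) : u = - u -> u = 0.
  by move=> /eqP; rewrite -addr_eq0 -mulr2n mulrn_eq0 /= => /eqP.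
case: beta x y {theta} => [|[|[|?]]] //=.
- move=> [? ? ? ?] [? ? ? ?] [] /eqN -> /eqN -> /eqN -> [] /eqN -> /eqN -> /eqN ->.
  by congr Quaternion; rewrite /= addr0.
- move=> [? ?] [? ?] [] /eqN -> [] /eqN ->.
  by congr Complex; rewrite /= addr0.
- move=> [? ? ? ?] [? ? ? ?] [] /eqN -> /eqN -> /eqN -> [] /eqN -> /eqN -> /eqN ->.
  by congr Quaternion; rewrite /= addr0.
Qed.

Lemma det_hermitian2 (R : realType) (beta : nat) (theta : 'M[coefs R beta]_2) :
  hermitian2 theta -> \det theta = creal beta (sigma theta).2.
Proof.
move=> h; rewrite /sigma /= det_mx2 (h ord0 ord_max).
have := h ord0 ord0; have := h ord_max ord_max.
move: (theta ord0 ord0) (theta ord_max ord_max) (theta ord0 ord_max) {h} => x y q.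
have eqN (u : R) : u = - u -> u = 0.
  by move=> /eqP; rewrite -addr_eq0 -mulr2n mulrn_eq0 /= => /eqP.
case: beta x y q {theta} => [|[|[|?]]] //=.
- move=> [? ? ? ?] [? ? ? ?] [? ? ? ?].
  move=> [] /eqN -> /eqN -> /eqN -> [] /eqN -> /eqN -> /eqN ->.
  by congr Quaternion; rewrite /=; ring.
- move=> [? ?] [? ?] [? ?] [] /eqN -> [] /eqN ->.
  by congr Complex; rewrite /=; ring.
- move=> [? ? ? ?] [? ? ? ?] [? ? ? ?].
  move=> [] /eqN -> /eqN -> /eqN -> [] /eqN -> /eqN -> /eqN ->.
  by congr Quaternion; rewrite /=; ring.
Qed.

Definition cosh (R : realType) (x : R) : R := (expR x + expR (- x)) / 2.
Definition sinh (R : realType) (x : R) : R := (expR x - expR (- x)) / 2.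

(* Euler's integral, meaningful for 0 < x. *)
Definition Gamma (R : realType) (x : R) : R :=
  \int[@lebesgue_measure R]_(t in `]0, +oo[) (t `^ (x - 1) * expR (- t)).

(* Meaningful for 0 < x, as the power of x / 2 is real. *)
Definition besselJ (R : realType) (nu x : R) : R :=
  limn (series (fun k : nat =>
    (-1) ^+ k / (k`!%:R * Gamma (k%:R + nu + 1)) * (x / 2) `^ (2 * k%:R + nu))).
Definition besselI (R : realType) (nu x : R) : R :=
  limn (series (fun k : nat =>
    1 / (k`!%:R * Gamma (k%:R + nu + 1)) * (x / 2) `^ (2 * k%:R + nu))).

(* The normalized Bessel functions are even entire functions with value 1 at 0;
   they are only needed, and only defined here, on 0 <= x. *)
Definition calJ (R : realType) (nu x : R) : R :=
  if x == 0 then 1 else Gamma (nu + 1) * (2 / x) `^ nu * besselJ nu x.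
Definition calI (R : realType) (nu x : R) : R :=
  if x == 0 then 1 else Gamma (nu + 1) * (2 / x) `^ nu * besselI nu x.

Definition U (R : realType) : set (R * R) := [set s | 4 * s.2 < s.1 ^+ 2].

Definition d1 (R : realType) (g : R * R -> R) : R * R -> R :=
  fun p => 'D_((1 : R), (0 : R)) g p.
Definition d2 (R : realType) (g : R * R -> R) : R * R -> R :=
  fun p => 'D_((0 : R), (1 : R)) g p.

Definition C1_on (R : realType) (D : set (R * R)) (g : R * R -> R) : Prop :=
  forall p, D p -> [/\ differentiable g p,
    {for p, continuous (d1 g)} & {for p, continuous (d2 g)}].
Definition C2_on (R : realType) (D : set (R * R)) (g : R * R -> R) : Prop :=
  [/\ C1_on D g, C1_on D (d1 g) & C1_on D (d2 g)].

(* A function on U is a total function whose values off U are irrelevant;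
   extU g is its extension by continuity to the closure of U. *)
Definition extU (R : realType) (g : R * R -> R) (p : R * R) : R :=
  lim (g @ within (@U R) (nbhs p)).

Definition solution (R : realType) (beta : nat) (a b : R) (g : R * R -> R)
  : Prop :=
  [/\ C2_on (@U R) g,
      (forall p, U p ->
        d1 (d1 g) p - p.2 * d2 (d2 g) p
          = beta%:R / 2 * d2 g p + (b ^+ 2 - 4 * a) * g p
        /\ 2 * d2 (d1 g) p + p.1 * d2 (d2 g) p = 0),
      cvg (g @ within (@U R) (nbhs ((0 : R), (0 : R)))),
      extU g (0, 0) = 1
    & is_derive (0 : R) (1 : R) (fun s : R => extU g (s, 0)) (- b)].

(* L is obtained from g: g(sigma theta) = exp(-4a ln L(theta) - b tr theta)
   wherever g > 0. *)
Definition obtained_from (R : realType) (beta : nat) (a b : R)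
    (g : R * R -> R) (L : 'M[coefs R beta]_2 -> R) : Prop :=
  forall theta, hermitian2 theta -> 0 < extU g (sigma theta) ->
    0 < L theta /\
    extU g (sigma theta) = expR (- (4 * a * ln (L theta)) - b * (sigma theta).1).

Definition given_by (R : realType) (beta : nat) (g : R * R -> R)
    (L F : 'M[coefs R beta]_2 -> R) : Prop :=
  forall theta, hermitian2 theta -> 0 < extU g (sigma theta) ->
    L theta = F theta.

(* Main.v *)
(** With [disc s = s.1 ^+ 2 - 4 * s.2], the second equation says that [g] is a
    function of [sigma_1] plus a function of [disc] on [U], and the first one then
    separates: [g = A sigma_1 + B disc] with [A'' - c A] equal to a constant [k]
    and [4 x B'' + (2 + 2 beta) B' - c B = - k], where [c = b ^+ 2 - 4 a]. Up to
    moving constants between [A] and [B], [A] solves a linear equation with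
    constant coefficients, and [f r = B (r ^+ 2)] solves the radial equation
    [f'' + beta f' / r = c f]. Since [g] has a limit at the origin, so has [f], and
    this leaves only the multiples of the regular solution, the entire function
    [psi (c x) = \sum_i (c x) ^+ i / (4 ^+ i * i`! * (p)_i)] with
    [p = (beta + 1) / 2], which is the normalized Bessel function at
    [kappa * sqrt x], modified or not according to the sign of [c]. The regular
    solutions extend smoothly across the boundary of [U], so the initial conditions
    can be read off the formulas. *)
Require Import Defs.
From mathcomp Require Import all_boot all_order all_algebra.
From mathcomp Require Import all_classical all_reals all_analysis.
From mathcomp Require Import complex.
From mathcomp Require Import measurable_realfun ring lra.
Import Order.TTheory GRing.Theory Num.Theory.
Import numFieldNormedType.Exports.
Local Open Scope classical_set_scope.
Local Open Scope ring_scope.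
Set Implicit Arguments.
Unset Strict Implicit.
Unset Printing Implicit Defensive.

(** * Calculus in one and two variables *)

Section DerivativeRules.
Context {R : realType}.
Implicit Types (f g : R -> R) (x : R).

Lemma is_derive_addf f g x df dg :
  is_derive x 1 f df -> is_derive x 1 g dg ->
  is_derive x 1 (fun t => f t + g t) (df + dg).
Proof. exact: is_deriveD. Qed.

Lemma is_derive_oppf f x df :
  is_derive x 1 f df -> is_derive x 1 (fun t => - f t) (- df).
Proof. exact: is_deriveN. Qed.

Lemma is_derive_mulf f g x df dg :
  is_derive x 1 f df -> is_derive x 1 g dg ->
  is_derive x 1 (fun t => f t * g t) (f x * dg + g x * df).
Proof. exact: is_deriveM. Qed.

Lemma is_derive_expf f n x df :
  is_derive x 1 f df ->
  is_derive x 1 (fun t => f t ^+ n) (n%:R * f x ^+ n.-1 * df).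
Proof.
move=> h; have := @is_deriveX _ _ f n x 1 df h.
by rewrite exprfctE.
Qed.

Lemma is_derive_compf f g x df dg :
  is_derive x 1 f df -> is_derive (f x) 1 g dg ->
  is_derive x 1 (fun t => g (f t)) (dg * df).
Proof. by move=> hf hg; have := @is_derive1_comp _ g f x dg df hg hf. Qed.

Lemma is_derive_cstf x (k : R) : is_derive x 1 (fun _ : R => k) 0.
Proof. exact: is_derive_cst. Qed.

Lemma is_derive_idf x : is_derive x 1 (fun t : R => t) 1.
Proof. exact: is_derive_id. Qed.

Lemma is_derive_cvg f x df : is_derive x 1 f df -> f t @[t --> x] --> f x.
Proof.
by move=> h; apply: differentiable_continuous; apply/derivable1_diffP.
Qed.

Lemma is_derive_unique f x d d' :
  is_derive x 1 f d -> is_derive x 1 f d' -> d = d'.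
Proof. by move=> h h'; rewrite -(@derive_val _ _ _ _ _ _ _ h) -(@derive_val _ _ _ _ _ _ _ h'). Qed.

End DerivativeRules.

(** Derivatives are computed from the shape of the expression. Assumptions are tried first, so that
    abstract functions get their derivatives from the context; [der_eq] leaves the equality with the
    expected value. *)
Ltac der := repeat first
  [ eassumption | eapply is_derive_cstf | eapply is_derive_idf
  | eapply is_derive_expf | eapply is_derive_addf | eapply is_derive_oppf
  | eapply is_derive_mulf ].

Ltac der_eq := eapply is_derive_eq; [der | rewrite /=].

Lemma is_derive_scalef {R : realType} (f f1 : R -> R) (c x : R) :
  (forall t : R, is_derive t 1 f (f1 t)) ->
  is_derive x 1 (fun t => f (c * t)) (c * f1 (c * x)).
Proof.
move=> h; have hc : is_derive x 1 (fun t : R => c * t) c by der_eq; ring.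
by rewrite mulrC; exact: is_derive_compf hc (h _).
Qed.

Section Monotone.
Context {R : realType}.
Implicit Types (f df : R -> R).

Lemma derive_nonincreasing f df (x y : R) : x <= y ->
  (forall t : R, x <= t <= y -> is_derive t 1 f (df t)) ->
  (forall t : R, x <= t <= y -> df t <= 0) -> f y <= f x.
Proof.
move=> xy hf hdf.
have [] := @MVT_segment R f df x y xy.
- by move=> t; rewrite in_itv => /andP[xt ty]; apply: hf; rewrite !ltW.
- by apply: derivable_within_continuous => t; rewrite in_itv => /hf [].
move=> z; rewrite in_itv => xzy e.
by rewrite -subr_le0 e; apply: mulr_le0_ge0; [exact: hdf | rewrite subr_ge0].
Qed.

(** Both [f] and [- f] are nonincreasing between the two points. [D] is any order-convex set, since
    the result is wanted on the positive half-line. *)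
Lemma derive0_const (D : R -> Prop) f (x y : R) :
  (forall u v t : R, D u -> D v -> u <= t <= v -> D t) ->
  (forall t : R, D t -> is_derive t 1 f 0) -> D x -> D y -> f x = f y.
Proof.
move=> iD hf; wlog xy : x y / x <= y.
  by move=> H Dx Dy; case: (leP x y) => [xy|/ltW yx]; [|apply/esym]; exact: H.
move=> Dx Dy.
have Dt t : x <= t <= y -> D t by exact: iD.
apply/eqP; rewrite eq_le -lerN2; apply/andP; split.
  apply: (@derive_nonincreasing (fun t => - f t) (fun=> 0) x y) => // t /Dt/hf h.
  by apply: is_derive_eq (is_derive_oppf h) _; rewrite oppr0.
by apply: (@derive_nonincreasing f (fun=> 0) x y) => // t /Dt/hf.
Qed.

End Monotone.

(** * Gradients in the plane *)

Section Plane.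
Context {R : realType}.
Implicit Types (F G : R * R -> R) (p : R * R).

(** Total differentiability with the two partial derivatives displayed as data, so that gradients
    can be computed by rules, as in one variable. *)
Definition has_grad F p (u v : R) : Prop :=
  is_diff p F (fun q => u * q.1 + v * q.2).

Lemma has_grad_eq F p u v u' v' :
  has_grad F p u v -> u = u' -> v = v' -> has_grad F p u' v'.
Proof. by move=> ? <- <-. Qed.

Lemma has_grad_cst (k : R) p : has_grad (fun=> k) p 0 0.
Proof.
apply: is_diff_eq (is_diff_cst k p) _.
by apply/funext => q; rewrite /= !mul0r addr0.
Qed.

Lemma has_grad_fst p : has_grad fst p 1 0.
Proof.
have cf : continuous (fst : R * R -> R) by move=> q; exact: cvg_fst.
have e := @diff_lin _ _ _ (fst : {linear (R * R)%type -> R}) p cf.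
apply: DiffDef; first exact: (@linear_differentiable _ _ _ (fst : {linear (R * R)%type -> R})).
by rewrite e; apply/funext => q /=; rewrite mul1r mul0r addr0.
Qed.

Lemma has_grad_snd p : has_grad snd p 0 1.
Proof.
have cf : continuous (snd : R * R -> R) by move=> q; exact: cvg_snd.
have e := @diff_lin _ _ _ (snd : {linear (R * R)%type -> R}) p cf.
apply: DiffDef; first exact: (@linear_differentiable _ _ _ (snd : {linear (R * R)%type -> R})).
by rewrite e; apply/funext => q /=; rewrite mul1r mul0r add0r.
Qed.

Lemma has_gradD F G p u v u' v' : has_grad F p u v -> has_grad G p u' v' ->
  has_grad (fun q => F q + G q) p (u + u') (v + v').
Proof.
move=> hF hG; apply: is_diff_eq (is_diffD hF hG) _.
by apply/funext => q /=; rewrite fctE; ring.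
Qed.

Lemma has_gradM F G p u v u' v' : has_grad F p u v -> has_grad G p u' v' ->
  has_grad (fun q => F q * G q) p (F p * u' + G p * u) (F p * v' + G p * v).
Proof.
move=> hF hG; apply: is_diff_eq (is_diffM hF hG) _.
by apply/funext => q /=; rewrite !fctE /GRing.scale /=; ring.
Qed.

Lemma has_grad_comp F (f : R -> R) p u v d : has_grad F p u v ->
  is_derive (F p) 1 f d -> has_grad (fun q => f (F q)) p (d * u) (d * v).
Proof.
move=> hF hf.
have df : differentiable f (F p) by apply/derivable1_diffP.
have hf' : is_diff (F p) f (fun h => h * d).
  apply: DiffDef => //; rewrite diff1E//.
  by apply/funext => h; rewrite derive1E derive_val.
apply: is_diff_eq (is_diff_comp hF hf') _.
by apply/funext => q /=; ring.
Qed.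

Lemma has_grad_differentiable F p u v : has_grad F p u v -> differentiable F p.
Proof. by case. Qed.

Lemma has_grad_continuous F p u v : has_grad F p u v -> {for p, continuous F}.
Proof. by move=> /has_grad_differentiable; exact: differentiable_continuous. Qed.

Lemma has_grad_d1 F p u v : has_grad F p u v -> d1 F p = u.
Proof.
by move=> [dF e]; rewrite /d1 deriveE// e /= mulr1 mulr0 addr0.
Qed.

Lemma has_grad_d2 F p u v : has_grad F p u v -> d2 F p = v.
Proof.
by move=> [dF e]; rewrite /d2 deriveE// e /= mulr1 mulr0 add0r.
Qed.

Lemma differentiable_has_grad F p :
  differentiable F p -> has_grad F p (d1 F p) (d2 F p).
Proof.
move=> dF; apply: DiffDef => //; apply/funext => q.
rewrite /d1 /d2 !deriveE// mulrC [X in _ + X]mulrC.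
rewrite -[_ * _]/(_ *: _) -[X in _ + X]/(_ *: _) -!linearZ -linearD /=.
by congr ('d F p _); case: q => a b; congr pair; rewrite /= /GRing.scale /=; ring.
Qed.

Lemma has_grad_curve F (x y : R -> R) (t u v dx dy : R) :
  is_derive t 1 x dx -> is_derive t 1 y dy -> has_grad F (x t, y t) u v ->
  is_derive t 1 (fun t => F (x t, y t)) (u * dx + v * dy).
Proof.
move=> hx hy hF.
have dpt (f : R -> R) (d : R) : is_derive t 1 f d -> is_diff t f (fun h : R => h * d).
  move=> h; have df : differentiable f t by apply/derivable1_diffP.
  apply: DiffDef => //; rewrite diff1E//.
  by apply/funext => k; rewrite derive1E derive_val.
have h := is_diff_comp (is_diff_pair (dpt _ _ hx) (dpt _ _ hy)) hF.
have dd : differentiable (fun t => F (x t, y t)) t by have [] := h.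
apply: DeriveDef; first exact: diff_derivable.
rewrite deriveE//; have [_ e] := h.
by change (('d (F \o (fun t => (x t, y t))) t : R -> R) 1 = u * dx + v * dy); rewrite e /=; ring.
Qed.

(** A solution agrees with a formula only on the open set [U], so locality is needed: the
    first-order expansion of [F] at [p] is also one of [G], and the differential is unique. *)
Lemma near_has_grad F G p u v :
  (\near p, F p = G p) -> has_grad F p u v -> has_grad G p u v.
Proof.
move=> FG [dF eF].
have FGp : F p = G p by exact: nbhs_singleton FG.
have oG : G \o shift p = cst (G p) + 'd F p +o_ (0 : R * R) id.
  apply/eqaddoP => e e0.
  have /eqaddoP/(_ e e0) h := diff_locally dF.
  have FG0 : \forall q \near (0 : R * R), F (q + p) = G (q + p).
    move: FG; rewrite -{1}[p]add0r => FG.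
    have cs : {for 0, continuous (fun q : R * R => q + p)}.
      by apply: cvgD; [exact: cvg_id | exact: cvg_cst].
    exact: (cs _ FG).
  near=> q.
  have -> : (G \o shift p - (cst (G p) + 'd F p)) q
          = (F \o shift p - (cst (F p) + 'd F p)) q.
    rewrite FGp; congr (_ - _); rewrite /=; apply/esym.
    by near: q.
  by near: q.
have cL := diff_continuous dF.
have e := diff_unique cL oG.
apply: DiffDef; last by rewrite e.
by apply/diff_locallyP; rewrite e; split.
Unshelve. all: by end_near. Qed.

End Plane.

(** * The Gamma function *)

Section GammaFunction.
Context {R : realType}.
Local Notation mu := (@lebesgue_measure R).
Implicit Types (x y t : R).

(** With [m = 2 * (y + 1)] and [s = t / m], raising [s <= expR s] to the power [y] gives the bound
    [expR (y * s)], and [y * s <= t / 2]. This controls Euler's integrand at infinity. *)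
Lemma powR_le_expR y : 0 <= y ->
  exists2 K, 0 < K & forall t, 0 <= t -> t `^ y <= K * expR (t / 2).
Proof.
move=> y0; pose m := 2 * (y + 1); have m0 : 0 < m by rewrite /m; lra.
exists (m `^ y + 1); first by rewrite ltr_wpDl// powR_ge0.
move=> t t0.
rewrite {1}(_ : t = m * (t / m)); last by rewrite mulrCA divff ?mulr1// gt_eqF.
rewrite powRM ?divr_ge0 ?(ltW m0)//.
set s := t / m; have s0 : 0 <= s by rewrite divr_ge0// ltW.
apply: ler_pM; rewrite ?powR_ge0//; first by rewrite lerDl.
have sE : s <= expR s by apply: le_trans (expR_ge1Dx s); lra.
apply: (@le_trans _ _ (expR s `^ y)).
  by apply: ge0_ler_powR => //; rewrite nnegrE ?expR_ge0.
rewrite -expRM ler_expR.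
have e : t = 2 * (y + 1) * s by rewrite /s mulrCA divff ?mulr1// gt_eqF.
nra.
Qed.

Lemma continuous_powR_ge0 y : 0 <= y ->
  {within `[0, +oo[, continuous (fun t : R => t `^ y)}.
Proof.
rewrite le_eqVlt => /predU1P[<-|y0].
  (* The exponent 0 is separate: the power is then the constant 1, also at the origin, where
     positive exponents give 0. *)
  under [X in continuous X]eq_fun do rewrite powRr0.
  by apply: continuous_subspaceT => z; exact: cvg_cst.
apply/continuous_within_itvcyP; split.
  move=> t; rewrite in_itv/= andbT => t0.
  exact: is_derive_cvg (is_derive1_powR _ t0).
by rewrite powR0 ?gt_eqF//; exact: powR_cvg0.
Qed.

(** The range [1 <= x] makes the integrand continuous up to the origin; it covers the arguments
    [k + nu + 1] with [0 <= nu] of the Bessel series. *)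
Lemma continuous_Gamma_integrand x : 1 <= x ->
  {within `[0, +oo[, continuous (fun t : R => t `^ (x - 1) * expR (- t))}.
Proof.
move=> x1 t; apply: cvgM.
  by apply: continuous_powR_ge0; rewrite subr_ge0.
apply: continuous_subspaceT => z.
by apply: continuous_comp; [exact: opp_continuous | exact: continuous_expR].
Qed.

Lemma is_derive_expR_scale (c t : R) :
  is_derive t (1 : R) (fun s => expR (- (c * s))) (- c * expR (- (c * t))).
Proof.
have h : is_derive t (1 : R) (fun s : R => - (c * s)) (- c) by der_eq; ring.
by apply: is_derive_eq (is_derive_compf h (is_derive_expR _)) _; rewrite mulrC.
Qed.

Lemma cvg_expR_scale (c : R) : 0 < c -> expR (- (c * t)) @[t --> +oo] --> (0 : R).
Proof.
move=> c0.
have h : c * t @[t --> +oo] --> +oo by apply: gt0_cvgMry => //; exact: cvg_id.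
exact: (cvg_comp _ _ h (@cvgr_expR R)).
Qed.

Lemma integral_expR_scale (a c K : R) : 0 < c -> 0 <= K ->
  (\int[mu]_(t in `[a, +oo[) (K * expR (- (c * t)))%:E
    = (K / c * expR (- (c * a)))%:E)%E.
Proof.
move=> c0 K0.
have dF t : is_derive t (1 : R) (fun t => - (K / c) * expR (- (c * t)))
    (K * expR (- (c * t))).
  have h := is_derive_expR_scale c t.
  by der_eq; field; rewrite gt_eqF.
have df t : is_derive t (1 : R) (fun t => K * expR (- (c * t)))
    (K * (- c * expR (- (c * t)))).
  have h := is_derive_expR_scale c t.
  by der_eq; ring.
rewrite (@ge0_continuous_FTC2y _ _ (fun t => - (K / c) * expR (- (c * t))) _ 0).
- by rewrite sub0e -EFinN mulNr opprK.
- by move=> t _; rewrite mulr_ge0// expR_ge0.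
- by apply: continuous_subspaceT => t; exact: is_derive_cvg (df t).
- rewrite -[X in _ --> X](mulr0 (- (K / c))).
  by apply: cvgM; [exact: cvg_cst | exact: cvg_expR_scale].
- by move=> t _; have [] := dF t.
- exact: cvg_at_right_filter (is_derive_cvg (dF a)).
- by move=> t _; rewrite derive1E; have := dF t => h; rewrite derive_val.
Qed.


Lemma powR_expR_cvg0 x : 0 <= x -> t `^ x * expR (- t) @[t --> +oo] --> (0 : R).
Proof.
move=> x0; have [K K0 hK] := powR_le_expR x0.
apply: (@squeeze_cvgr _ _ _ _ (fun=> 0) (fun t => K * expR (- (2^-1 * t)))).
- near=> t; have t0 : 0 <= t by near: t; exact: nbhs_pinfty_ge.
  rewrite mulr_ge0 ?powR_ge0 ?expR_ge0//=.
  apply: le_trans (ler_wpM2r (expR_ge0 _) (hK _ t0)) _.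
  by rewrite -mulrA -expRD ler_wpM2l ?(ltW K0)// ler_expR; lra.
- exact: cvg_cst.
- rewrite -[X in _ --> X](mulr0 K); apply: cvgM; first exact: cvg_cst.
  by apply: cvg_expR_scale; rewrite invr_gt0.
Unshelve. all: by end_near. Qed.

(** Euler's integral with extended real values, so that nonnegative integrals can be added before
    finiteness is known, and on a closed half-line, as the fundamental theorem of calculus
    requires. *)
Definition Gamma_integral x : \bar R :=
  (\int[mu]_(t in `[0%R, +oo[) (t `^ (x - 1) * expR (- t))%:E)%E.

(* The derivative of [- t `^ x * expR (- t)] changes sign; adding [H] makes it
   nonnegative, so that the fundamental theorem of calculus for nonnegative
   functions applies and no integrability is needed. *)
Lemma Gamma_integralS x : 1 <= x ->
  Gamma_integral (x + 1) = (x%:E * Gamma_integral x)%E.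
Proof.
move=> x1; have x0 : 0 <= x by lra.
have [K' K'0 hK'] := @powR_le_expR (x - 1) ltac:(lra).
(* This constant makes [H], which decays like [expR (- t / 2)], dominate the negative term [G0]. *)
pose K := x * K'; have K0 : 0 <= K by rewrite mulr_ge0// ltW.
pose G1 t : R := t `^ x * expR (- t).
pose G0 t : R := x * (t `^ (x - 1) * expR (- t)).
pose H t : R := K * expR (- (2^-1 * t)).
pose f t := G1 t - G0 t + H t.
pose F t := - G1 t - 2 * H t.
have G1_ge0 t : 0 <= G1 t by rewrite mulr_ge0 ?powR_ge0 ?expR_ge0.
have G0_ge0 t : 0 <= G0 t by rewrite !mulr_ge0 ?powR_ge0 ?expR_ge0.
have H_ge0 t : 0 <= H t by rewrite mulr_ge0 ?expR_ge0.
have f_ge0 t : 0 <= t -> 0 <= f t.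
  move=> t0; suff : G0 t <= H t by have := G1_ge0 t; rewrite /f; lra.
  rewrite /G0 /H /K -mulrA ler_wpM2l//.
  apply: le_trans (ler_wpM2r (expR_ge0 _) (hK' _ t0)) _.
  by rewrite -mulrA -expRD ler_wpM2l ?(ltW K'0)// ler_expR; lra.
have dH t : is_derive t (1 : R) H (- (2^-1 * H t)).
  have h := is_derive_expR_scale 2^-1 t.
  by rewrite /H; der_eq; ring.
have cG1 : {within `[0, +oo[, continuous G1}.
  have := @continuous_Gamma_integrand (x + 1) ltac:(lra).
  by rewrite addrK.
have cG0 : {within `[0, +oo[, continuous G0}.
  move=> t; apply: cvgM; first exact: cvg_cst.
  exact: continuous_Gamma_integrand.
have cH : {within `[0, +oo[, continuous H}.
  by apply: continuous_subspaceT => t; exact: is_derive_cvg (dH t).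
have cf : {within `[0, +oo[, continuous f}.
  move=> t; apply: cvgD; last exact: cH.
  by apply: cvgB; [exact: cG1 | exact: cG0].
have dF t : 0 < t -> is_derive t (1 : R) F (f t).
  move=> t0; have h1 := @is_derive1_powR _ x _ t0.
  have h2 : is_derive t (1 : R) (fun s : R => expR (- s)) (- expR (- t)).
    apply: is_derive_eq (is_derive_compf (is_derive_oppf (is_derive_idf t)) (is_derive_expR _)) _.
    by ring.
  have h3 := dH t.
  by rewrite /F /G1; der_eq; rewrite /f /G1 /G0; field.
have intf : (\int[mu]_(t in `[0%R, +oo[) (f t)%:E = (2 * K)%:E)%E.
  rewrite (@ge0_continuous_FTC2y _ _ F _ 0).
  - rewrite sub0e -EFinN /F /G1 /H powR0 ?gt_eqF//; last lra.
    by rewrite mulr0 oppr0 expR0 mul0r; congr EFin; ring.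
  - exact: f_ge0.
  - exact: cf.
  - rewrite -[X in _ --> X](_ : - 0 - 2 * 0 = 0); last by ring.
    apply: cvgB; first by apply: cvgN; exact: powR_expR_cvg0.
    apply: cvgM; first exact: cvg_cst.
    rewrite -[X in _ --> X](mulr0 K); apply: cvgM; first exact: cvg_cst.
    by apply: cvg_expR_scale; rewrite invr_gt0.
  - by move=> t /dF [].
  - apply: cvgB.
      by apply: cvgN; have /continuous_within_itvcyP[] := cG1.
    apply: cvgM; first exact: cvg_cst.
    by have /continuous_within_itvcyP[] := cH.
  - move=> t; rewrite in_itv/= andbT => /dF h.
    by rewrite derive1E derive_val.
have intH : (\int[mu]_(t in `[0%R, +oo[) (H t)%:E = (2 * K)%:E)%E.
  rewrite integral_expR_scale ?invr_gt0//.
  by rewrite mulr0 oppr0 expR0; congr EFin; field.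
have meas (h : R -> R) : {within `[0, +oo[, continuous h} ->
    measurable_fun (`[0, +oo[%classic : set R) (EFin \o h).
  move=> ch; apply/measurable_EFinP.
  exact: subspace_continuous_measurable_fun.
(* This integrates [f + G0 = G1 + H]. Both [f] and [H] have the finite integral [2 * K], which
   therefore cancels. *)
have e : ((2 * K)%:E + x%:E * Gamma_integral x =
          Gamma_integral (x + 1) + (2 * K)%:E)%E.
  have -> : (x%:E * Gamma_integral x = \int[mu]_(t in `[0%R, +oo[) (G0 t)%:E)%E.
    rewrite /Gamma_integral -ge0_integralZl_EFin//.
    - by move=> t _; rewrite lee_fin mulr_ge0 ?powR_ge0 ?expR_ge0.
    - by apply: meas; exact: continuous_Gamma_integrand.
  rewrite /Gamma_integral addrK -[X in (X + _ = _)%E]intf -[X in (_ = _ + X)%E]intH.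
  rewrite -ge0_integralD//; last 4 first.
  - by move=> t; rewrite /= in_itv/= andbT => t0; rewrite lee_fin f_ge0.
  - exact: meas.
  - by move=> t _; rewrite lee_fin G0_ge0.
  - exact: meas.
  rewrite -ge0_integralD//; last 4 first.
  - by move=> t _; rewrite lee_fin G1_ge0.
  - exact: meas.
  - by move=> t _; rewrite lee_fin H_ge0.
  - exact: meas.
  apply: eq_integral => t _; rewrite -!EFinD; congr EFin.
  by rewrite /f /G1; ring.
move: e; rewrite addeC => /(congr1 (fun z => z - (2 * K)%:E)%E).
by rewrite !addeK.
Qed.

Lemma Gamma_integral_fin x : 1 <= x -> Gamma_integral x \is a fin_num.
Proof.
move=> x1; have [K K0 hK] := @powR_le_expR (x - 1) ltac:(lra).
rewrite ge0_fin_numE; last first.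
  by apply: integral_ge0 => t _; rewrite lee_fin mulr_ge0 ?powR_ge0 ?expR_ge0.
have h : (Gamma_integral x <=
          \int[mu]_(t in `[0%R, +oo[) (K * expR (- (2^-1 * t)))%:E)%E.
  apply: ge0_le_integral => //.
  - by move=> t _; rewrite lee_fin mulr_ge0 ?powR_ge0 ?expR_ge0.
  - apply/measurable_EFinP; apply: subspace_continuous_measurable_fun => //.
    exact: continuous_Gamma_integrand.
  - apply/measurable_EFinP; apply: subspace_continuous_measurable_fun => //.
    apply: continuous_subspaceT => t; apply: cvgM; first exact: cvg_cst.
    exact: is_derive_cvg (is_derive_expR_scale _ _).
  - move=> t; rewrite /= in_itv/= andbT => t0; rewrite lee_fin.
    apply: le_trans (ler_wpM2r (expR_ge0 _) (hK _ t0)) _.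
    by rewrite -mulrA -expRD ler_wpM2l ?(ltW K0)// ler_expR; lra.
rewrite (le_lt_trans h)//.
by rewrite integral_expR_scale ?invr_gt0 ?(ltW K0)// ltry.
Qed.

(** On [[1, +oo[] the power of [t] is at least 1, so the integral of [expR (- t)] over that
    half-line is a positive lower bound. *)
Lemma Gamma_integral_gt0 x : 1 <= x -> (0 < Gamma_integral x)%E.
Proof.
move=> x1.
have meas : measurable_fun (`[0, +oo[%classic : set R)
    (fun t : R => (t `^ (x - 1) * expR (- t))%:E).
  apply/measurable_EFinP; apply: subspace_continuous_measurable_fun => //.
  exact: continuous_Gamma_integrand.
have sub : (`[1%R, +oo[%classic : set R) `<=` `[0%R, +oo[%classic.
  by move=> t; rewrite /= !in_itv/= !andbT => t1; lra.
have h : (\int[mu]_(t in `[1%R, +oo[) (1 * expR (- (1 * t)))%:E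
          <= Gamma_integral x)%E.
  apply: (@le_trans _ _
    (\int[mu]_(t in `[1%R, +oo[) (t `^ (x - 1) * expR (- t))%:E)%E); last first.
    apply: (@ge0_subset_integral _ _ _ mu `[1, +oo[) => //.
    by move=> t _; rewrite lee_fin mulr_ge0 ?powR_ge0 ?expR_ge0.
  apply: ge0_le_integral => //.
  - apply/measurable_EFinP; apply: subspace_continuous_measurable_fun => //.
    apply: continuous_subspaceT => t; apply: cvgM; first exact: cvg_cst.
    exact: is_derive_cvg (is_derive_expR_scale _ _).
  - exact: measurable_funS meas.
  - move=> t; rewrite /= in_itv/= andbT => t1; rewrite lee_fin [1 * t]mul1r.
    rewrite ler_wpM2r ?expR_ge0// -[leLHS](powRr0 t).
    by apply: ler_powR => //; rewrite subr_ge0.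
apply: lt_le_trans h.
by rewrite integral_expR_scale// lte_fin mulr_gt0 ?expR_gt0// divr_gt0.
Qed.

(** [Gamma] integrates over the open half-line; the endpoint is a null set. *)
Lemma GammaE x : 1 <= x -> Gamma x = fine (Gamma_integral x).
Proof.
move=> x1; rewrite /Gamma /Rintegral; congr fine.
apply: integral_itv_obnd_cbnd; apply/measurable_EFinP.
apply: measurable_funS (_ : measurable_fun (`[0, +oo[%classic : set R) _) => //.
  by apply: subset_itvr; rewrite bnd_simp.
apply: subspace_continuous_measurable_fun => //.
exact: continuous_Gamma_integrand.
Qed.

Lemma GammaS x : 1 <= x -> Gamma (x + 1) = x * Gamma x.
Proof.
move=> x1; rewrite !GammaE//; last lra.
by rewrite Gamma_integralS// fineM// Gamma_integral_fin.
Qed.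

Lemma Gamma_gt0 x : 1 <= x -> 0 < Gamma x.
Proof.
move=> x1; rewrite GammaE// fine_gt0// Gamma_integral_gt0//=.
by rewrite -ge0_fin_numE ?Gamma_integral_fin// ltW// Gamma_integral_gt0.
Qed.

End GammaFunction.

(** * Power series of the normalized Bessel functions *)

Section ExponentialGeneratingFunction.
Context {R : realType}.
Implicit Types (e : nat -> R) (x : R).

(** Exponential generating functions suit the Bessel series: if the [e i] are bounded by 1, the
    exponential series dominates, and differentiation is a shift of [e]. *)
Definition egf_coeff e (i : nat) : R := e i / i`!%:R.

Definition egf e x : R := limn (pseries (egf_coeff e) x).

Lemma is_cvg_egf e x : (forall i, `|e i| <= 1) -> cvgn (pseries (egf_coeff e) x).
Proof.
move=> e1; apply: normed_cvg.
apply: (@series_le_cvg _ _ (fun n => exp_coeff `|x| n)).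
- by move=> n; exact: normr_ge0.
- by move=> n; rewrite /exp_coeff/= divr_ge0// exprn_ge0.
- move=> n; rewrite /exp_coeff/= normrM normrX normrM normfV.
  rewrite [X in _ / X]ger0_norm// mulrAC ler_wpM2r ?invr_ge0//.
  by rewrite -[leRHS]mul1r ler_wpM2r// exprn_ge0.
- exact: is_cvg_series_exp_coeff.
Qed.

Lemma pseries_diffs_egf e :
  pseries_diffs (egf_coeff e) = egf_coeff (fun i => e i.+1).
Proof.
apply/funext => i; rewrite /pseries_diffs /egf_coeff factS natrM invfM.
rewrite mulrCA; congr (_ * _); rewrite mulrA divff ?mul1r//.
Qed.

Lemma is_derive_egf e x : (forall i, `|e i| <= 1) ->
  is_derive x (1 : R) (egf e) (egf (fun i => e i.+1) x).
Proof.
move=> e1; rewrite /egf -pseries_diffs_egf.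
apply: (@pseries_snd_diffs _ _ (`|x| + 1)).
- exact: is_cvg_egf.
- by rewrite pseries_diffs_egf; apply: is_cvg_egf.
- by rewrite !pseries_diffs_egf; apply: is_cvg_egf.
- by rewrite [ltRHS]ger0_norm// ltrDl.
Qed.

Lemma egf0 e : egf e 0 = e 0%N.
Proof.
apply: lim_near_cst => //; near=> n.
have [m ->] : exists m, n = m.+1.
  by exists n.-1; rewrite prednK//; near: n; exact: nbhs_infty_gt.
rewrite /pseries /series/= big_nat_recl// big1 ?addr0.
  by rewrite /egf_coeff fact0 expr0 divr1 mulr1.
by move=> i _; rewrite exprS mul0r mulr0.
Unshelve. all: by end_near. Qed.

(** The partial sums [s] are evaluated twice. Their term of index 0 vanishes, so an index shift
    gives [x] times the second derivative; the recurrence, solved for [i%:R * e i.+1], gives a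
    quarter of the function minus [p] times its first derivative. *)
Lemma egf_ode e (p x : R) : (forall i, `|e i| <= 1) ->
  (forall i, 4 * (p + i%:R) * e i.+1 = e i) ->
  4 * x * egf (fun i => e i.+2) x + 4 * p * egf (fun i => e i.+1) x = egf e x.
Proof.
move=> e1 he.
pose s := pseries (egf_coeff (fun i => i%:R * e i.+1)) x.
have sS n : s n.+1 = x * pseries (egf_coeff (fun i => e i.+2)) x n.
  rewrite /s /pseries /series /= big_nat_recl// /egf_coeff !mul0r add0r.
  rewrite mulr_sumr; apply: eq_bigr => i _.
  rewrite factS natrM exprS; field.
  by rewrite nat1r !pnatr_eq0 -lt0n fact_gt0.
have sE n : s n = 4^-1 * pseries (egf_coeff e) x n
                  - p * pseries (egf_coeff (fun i => e i.+1)) x n.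
  rewrite /s /pseries /series /= !mulr_sumr -sumrB; apply: eq_bigr => i _.
  rewrite /egf_coeff -[in RHS](he i); field.
  by rewrite pnatr_eq0 -lt0n fact_gt0.
have l1 : s n @[n --> \oo] --> x * egf (fun i => e i.+2) x.
  rewrite -cvg_shiftS /=; under eq_fun do rewrite sS.
  by apply: cvgM; [exact: cvg_cst | apply: is_cvg_egf].
have l2 : s n @[n --> \oo] --> 4^-1 * egf e x - p * egf (fun i => e i.+1) x.
  under eq_fun do rewrite sE.
  by apply: cvgB; (apply: cvgM; [exact: cvg_cst | apply: is_cvg_egf]).
have h := cvg_unique (@norm_hausdorff _ _) l1 l2.
by rewrite -[4 * x * _]mulrA h; field.
Qed.

End ExponentialGeneratingFunction.

(** * The normalized Bessel functions as entire functions *)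

Section NormalizedBessel.
Context {R : realType}.
Implicit Types (p x nu : R).

(** This is the inverse of [4 ^+ i] times the rising factorial of [p]; the factor [i!] of the series
    is supplied by [egf_coeff]. *)
Definition bessel_coeff p (i : nat) : R := \prod_(j < i) (4 * (p + j%:R))^-1.

Lemma bessel_coeffS p i : 1 <= p ->
  4 * (p + i%:R) * bessel_coeff p i.+1 = bessel_coeff p i.
Proof.
move=> p1; rewrite /bessel_coeff big_ord_recr/= mulrCA divff ?mulr1//.
by rewrite mulf_neq0 ?pnatr_eq0// gt_eqF// ltr_wpDr// (lt_le_trans ltr01).
Qed.

Lemma bessel_coeff_norm p i : 1 <= p -> `|bessel_coeff p i| <= 1.
Proof.
move=> p1; rewrite /bessel_coeff; elim: i => [|i IH].
  by rewrite big_ord0 normr1.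
rewrite big_ord_recr/= normrM -[leRHS]mulr1 ler_pM//.
have h : 1 <= 4 * (p + i%:R) by have := ler0n R i; lra.
by rewrite normfV invf_le1 ?ger0_norm//; lra.
Qed.

(* The [n]-th derivative of the entire function [psi] of the introduction. *)
Definition dpsi (n : nat) p : R -> R := egf (fun i => bessel_coeff p (n + i)%N).

Lemma is_derive_dpsi n p x : 1 <= p ->
  is_derive x (1 : R) (dpsi n p) (dpsi n.+1 p x).
Proof.
move=> p1; rewrite /dpsi.
have -> : (fun i => bessel_coeff p (n.+1 + i)) = (fun i => bessel_coeff p (n + i.+1)).
  by apply/funext => i; rewrite addSnnS.
by apply: is_derive_egf => i; exact: bessel_coeff_norm.
Qed.

Lemma psi0 p : dpsi 0 p 0 = 1.
Proof. by rewrite /dpsi egf0 /bessel_coeff big_ord0. Qed.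

Lemma psi_ode p x : 1 <= p ->
  4 * x * dpsi 2 p x + 4 * p * dpsi 1 p x = dpsi 0 p x.
Proof.
move=> p1; apply: egf_ode => i; first exact: bessel_coeff_norm.
exact: bessel_coeffS.
Qed.

Lemma GammaDn x (k : nat) : 1 <= x ->
  Gamma (k%:R + x) = (\prod_(j < k) (x + j%:R)) * Gamma x.
Proof.
move=> x1; elim: k => [|k IH]; first by rewrite big_ord0 mul1r add0r.
have h := ler0n R k.
rewrite -natr1 addrAC GammaS; last lra.
by rewrite IH big_ord_recr/=; ring.
Qed.

(** The constant [c] is [-1] for [besselJ] and [1] for [besselI]. The powers with exponent [nu]
    cancel and the quotient of Gamma values is a rising factorial, so the two series are
    proportional term by term, with ratio [C^-1]. *)
Lemma bessel_series_psi (c nu x : R) : 0 <= nu -> 0 < x ->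
  Gamma (nu + 1) * (2 / x) `^ nu * limn (series (fun k : nat =>
    c ^+ k / (k`!%:R * Gamma (k%:R + nu + 1)) * (x / 2) `^ (2 * k%:R + nu)))
  = dpsi 0 (nu + 1) (c * x ^+ 2).
Proof.
move=> nu0 x0; set u := (fun k => _).
have G0 : 0 < Gamma (nu + 1) by apply: Gamma_gt0; lra.
have x20 : 0 < x / 2 by rewrite divr_gt0.
pose C := Gamma (nu + 1) * (2 / x) `^ nu.
pose v k := egf_coeff (bessel_coeff (nu + 1)) k * (c * x ^+ 2) ^+ k.
have inv_pw : (2 / x) `^ nu * (x / 2) `^ nu = 1.
  rewrite -powRM ?divr_ge0 ?(ltW x0)//.
  by rewrite mulrA divfK ?gt_eqF// divff ?gt_eqF// powR1.
have pw1 : (2 / x) `^ nu != 0 by apply: lt0r_neq0; rewrite powR_gt0// divr_gt0.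
have uE k : u k = C^-1 * v k.
  have P0 : \prod_(j < k) (nu + 1 + j%:R) != 0.
    apply/prodf_neq0 => j _; have := ler0n R j; move=> h.
    by apply: lt0r_neq0; lra.
  have -> : v k = (c * x ^+ 2) ^+ k / (4 ^+ k * (\prod_(j < k) (nu + 1 + j%:R)) * k`!%:R).
    rewrite /v /egf_coeff /bessel_coeff prodfV big_split/= prodr_const card_ord.
    field; by rewrite P0 expf_neq0//= pnatr_eq0 -lt0n fact_gt0.
  rewrite /u -[k%:R + nu + 1]addrA GammaDn; last lra.
  rewrite powRD; last by rewrite (gt_eqF x20) implybT.
  rewrite -natrM powR_mulrn ?ltW// exprM !exprMn.
  have -> : (x / 2) `^ nu = ((2 / x) `^ nu)^-1.
    by apply: (mulfI pw1); rewrite inv_pw divff.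
  rewrite /C !exprVn.
  have -> : 4 ^+ k = 2 ^+ k * 2 ^+ k :> R by rewrite -exprMn; congr (_ ^+ _); ring.
  field.
  by rewrite pw1 P0 (gt_eqF G0) expf_neq0//= pnatr_eq0 -lt0n fact_gt0.
have -> : series u = (fun n => C^-1 * pseries (egf_coeff (bessel_coeff (nu + 1))) (c * x ^+ 2) n).
  apply/funext => n; rewrite /pseries /series /= mulr_sumr.
  by apply: eq_bigr => i _; rewrite uE.
have nu1 : 1 <= nu + 1 by lra.
have h : cvgn (pseries (egf_coeff (bessel_coeff (nu + 1))) (c * x ^+ 2)).
  by apply: is_cvg_egf => i; exact: bessel_coeff_norm.
rewrite (cvg_lim _ (cvgM (cvg_cst _) h))//.
rewrite -/C mulrA divff ?mul1r//.
by rewrite mulf_neq0// gt_eqF.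
Qed.

Lemma calJE nu x : 0 <= nu -> 0 <= x -> calJ nu x = dpsi 0 (nu + 1) (- x ^+ 2).
Proof.
move=> nu0; rewrite /calJ le_eqVlt => /predU1P[<-|x0].
  by rewrite eqxx expr0n/= oppr0 psi0.
by rewrite gt_eqF// -mulN1r -bessel_series_psi.
Qed.

Lemma calIE nu x : 0 <= nu -> 0 <= x -> calI nu x = dpsi 0 (nu + 1) (x ^+ 2).
Proof.
move=> nu0; rewrite /calI le_eqVlt => /predU1P[<-|x0].
  by rewrite eqxx expr0n/= psi0.
rewrite gt_eqF// -[x ^+ 2]mul1r -bessel_series_psi//.
by under [in RHS]eq_fun do rewrite expr1n.
Qed.

End NormalizedBessel.

(** * Ordinary differential equations *)

Section LinearODE.
Context {R : realType}.

(** The operator factors: [A1 + k * A] and [A1 - k * A] solve first-order equations, so [P] and [Q]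
    are constant, and [A] is recovered from their difference. *)
Lemma ode_exp (A A1 A2 : R -> R) (k : R) : k != 0 ->
  (forall t : R, is_derive t 1 A (A1 t)) ->
  (forall t : R, is_derive t 1 A1 (A2 t)) ->
  (forall t, A2 t = k ^+ 2 * A t) ->
  exists C1 C2 : R, forall t, A t = C1 * expR (k * t) + C2 * expR (- (k * t)).
Proof.
move=> k0 hA hA1 hA2.
have dexp (c t : R) : is_derive t (1 : R) (fun s => expR (c * s)) (c * expR (c * t)).
  by apply: is_derive_scalef => s; exact: is_derive_expR.
pose P t := (A1 t + k * A t) * expR (- k * t).
pose Q t := (A1 t - k * A t) * expR (k * t).
have cP t : P t = P 0.
  apply: is_derive_0_is_cst => s; have h := dexp (- k) s.
  have := hA s; have := hA1 s; rewrite hA2 => h1 h2.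
  by rewrite /P; der_eq; ring.
have cQ t : Q t = Q 0.
  apply: is_derive_0_is_cst => s; have h := dexp k s.
  have := hA s; have := hA1 s; rewrite hA2 => h1 h2.
  by rewrite /Q; der_eq; ring.
exists (P 0 / (2 * k)), (- (Q 0 / (2 * k))) => t.
have e : expR (k * t) * expR (- (k * t)) = 1 by rewrite -expRD subrr expR0.
rewrite -(cP t) -(cQ t) /P /Q -[LHS]mulr1 -[X in A t * X = _]e !mulNr.
by field.
Qed.

(** The vector with coordinates [A] and [A1 / k] rotates at speed [k]; [P] and [Q] are its
    coordinates in the rotating frame, hence constant. *)
Lemma ode_trig (A A1 A2 : R -> R) (k : R) : k != 0 ->
  (forall t : R, is_derive t 1 A (A1 t)) ->
  (forall t : R, is_derive t 1 A1 (A2 t)) ->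
  (forall t, A2 t = - k ^+ 2 * A t) ->
  exists C1 C2 : R, forall t, A t = C1 * cos (k * t) + C2 * sin (k * t).
Proof.
move=> k0 hA hA1 hA2.
have dsin (t : R) : is_derive t (1 : R) (fun s => sin (k * s)) (k * cos (k * t)).
  by apply: (@is_derive_scalef R sin cos) => s; exact: is_derive_sin.
have dcos (t : R) : is_derive t (1 : R) (fun s => cos (k * s)) (k * - sin (k * t)).
  by apply: (@is_derive_scalef R cos (fun t => - sin t)) => s; exact: is_derive_cos.
pose P t := A t * cos (k * t) - A1 t / k * sin (k * t).
pose Q t := A t * sin (k * t) + A1 t / k * cos (k * t).
have cP t : P t = P 0.
  apply: is_derive_0_is_cst => s; have h := dsin s; have h' := dcos s.
  have := hA s; have := hA1 s; rewrite hA2 => h1 h2.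
  by rewrite /P; der_eq; field.
have cQ t : Q t = Q 0.
  apply: is_derive_0_is_cst => s; have h := dsin s; have h' := dcos s.
  have := hA s; have := hA1 s; rewrite hA2 => h1 h2.
  by rewrite /Q; der_eq; field.
exists (P 0), (Q 0) => t; rewrite -(cP t) -(cQ t) /P /Q.
by rewrite -[LHS]mulr1 -[X in A t * X = _](cos2Dsin2 (k * t)); ring.
Qed.

Lemma ode_quadratic (A A1 A2 : R -> R) (k : R) :
  (forall t : R, is_derive t 1 A (A1 t)) ->
  (forall t : R, is_derive t 1 A1 (A2 t)) ->
  (forall t, A2 t = k) ->
  forall t, A t = A 0 + A1 0 * t + k / 2 * t ^+ 2.
Proof.
move=> hA hA1 hA2.
have c1 t : A1 t - k * t = A1 0 - k * 0.
  apply: (@is_derive_0_is_cst _ (fun t => A1 t - k * t)) => s.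
  have := hA1 s; rewrite hA2 => h1.
  by der_eq; ring.
have c0 t : A t - (A1 0 * t + k / 2 * t ^+ 2) = A 0 - (A1 0 * 0 + k / 2 * 0 ^+ 2).
  apply: (@is_derive_0_is_cst _ (fun t => A t - (A1 0 * t + k / 2 * t ^+ 2))) => s.
  have h := hA s; der_eq; have := c1 s; rewrite expr1; lra.
by move=> t; have := c0 t; rewrite expr0n/=; lra.
Qed.

End LinearODE.

(** * The radial equation and its singularity at the origin *)

Section RadialODE.
Context {R : realType}.
Variables (n : nat) (c : R).
Hypothesis n0 : (0 < n)%N.

Definition radial_ode (f f1 : R -> R) : Prop := forall r : R, 0 < r ->
  is_derive r 1 f (f1 r) /\
  is_derive r 1 f1 (c * f r - n%:R * f1 r / r).

(* [r ^+ n * f1 r] has derivative [c * r ^+ n * f r], and the mean value theorem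
   gives points [xi] tending to [0] where [xi * f1 xi] tends to [0]. *)
Lemma radial_ode_derive_le (f f1 : R -> R) : radial_ode f f1 ->
  f r @[r --> 0^'+] --> (0 : R) ->
  exists2 d : R, 0 < d & forall r, 0 < r < d -> f1 r <= `|c| * r.
Proof.
move=> ode f0.
have small (e : R) : 0 < e -> exists2 d : R, 0 < d & forall r, 0 < r < d -> `|f r| <= e.
  move=> e0; have /cvgrPdist_le/(_ e e0) := f0.
  move=> [d /= d0 hd]; exists d => // r /andP[r0 rd].
  have := hd r; rewrite /= sub0r normrN gtr0_norm// => /(_ rd r0).
  by rewrite sub0r normrN.
have [d d0 hd] := small 1 ltr01.
exists d => // r /andP[r0 rd].
(* The derivative of [H] is [t ^+ n * (c * f t - n.+1%:R * |c|)], which is nonpositive below [d],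
   where [|f|] is at most 1. So [H r] is bounded by the value of [H] at any smaller point. *)
pose H t := t ^+ n * f1 t - `|c| * t ^+ n.+1.
suff He e : 0 < e -> H r <= e.
  have : H r <= 0 by apply/ler_addgt0Pr => e e0; rewrite add0r He.
  have -> : H r = r ^+ n * (f1 r - `|c| * r) by rewrite /H exprS; ring.
  by rewrite pmulr_rle0 ?exprn_gt0// subr_le0.
move=> e0.
have [d' d'0 hd'] := small (e / 4) ltac:(lra).
pose m := Num.min (Num.min r 1) d'.
have m0 : 0 < m by rewrite !lt_min r0 d'0 ltr01.
have [mr m1 md'] : [/\ m <= r, m <= 1 & m <= d'] by rewrite !ge_min !lexx !orbT.
(* On this segment [xi] is at most twice the length [m / 4], so [|xi * f1 xi|] is at most twice the
   increment of [f], hence at most [e]. The bound [m <= 1] then absorbs the remaining factor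
   [xi ^+ n.-1]. *)
have [|||xi] := @MVT_segment R f f1 (m / 4) (m / 2).
- lra.
- by move=> t; rewrite in_itv/= => /andP[t1 _]; apply (ode t); lra.
- apply: derivable_within_continuous => t; rewrite in_itv/= => /andP[t1 _].
  by have [|[]] := ode t; first lra.
rewrite in_itv/= => /andP[xi1 xi2] mvt.
have xi0 : 0 < xi by lra.
have hxi : `|xi * f1 xi| <= e.
  rewrite normrM gtr0_norm//.
  apply: (@le_trans _ _ (2 * `|f1 xi * (m / 2 - m / 4)|)).
    rewrite normrM [`|m / 2 - _|]gtr0_norm; last lra.
    by have := normr_ge0 (f1 xi); nra.
  rewrite -mvt; have := ler_normB (f (m / 2)) (f (m / 4)).
  have := hd' (m / 2) ltac:(lra); have := hd' (m / 4) ltac:(lra); lra.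
have Hdec : H r <= H xi.
  apply: (@derive_nonincreasing _ H
    (fun t => t ^+ n * (c * f t - n.+1%:R * `|c|)) xi r); first lra.
    move=> t /andP[xt tr]; have t0 : 0 < t by lra.
    have [h h1] := ode t t0.
    rewrite /H; der_eq; rewrite -(prednK n0) /= exprS -!natr1; field.
    by rewrite gt_eqF.
  move=> t /andP[xt tr]; have t0 : 0 < t by lra.
  apply: mulr_ge0_le0; first by rewrite exprn_ge0// ltW.
  have ft := hd t ltac:(lra).
  have : c * f t <= `|c| * 1.
    by apply: le_trans (ler_norm _) _; rewrite normrM ler_wpM2l.
  rewrite -natr1; have := normr_ge0 c; have := ler0n R n; nra.
apply: le_trans Hdec _; rewrite /H lerBlDr ler_wpDr ?mulr_ge0 ?exprn_ge0 ?(ltW xi0)//.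
rewrite -(prednK n0) exprSr -mulrA.
apply: le_trans (ler_norm _) _; rewrite normrM -[leRHS]mul1r.
apply: ler_pM => //; rewrite ger0_norm ?exprn_ge0 ?(ltW xi0)//.
by apply: exprn_ile1; lra.
Qed.

(** By linearity the one-sided bound on [f1] also applies to [- f1]. *)
Lemma radial_ode_opp (f f1 : R -> R) : radial_ode f f1 ->
  radial_ode (fun t => - f t) (fun t => - f1 t).
Proof.
move=> ode r r0; have [h h1] := ode r r0; split; first exact: is_derive_oppf.
by apply: is_derive_eq (is_derive_oppf h1) _; field; rewrite gt_eqF.
Qed.

(* The energy [f ^+ 2 + f1 ^+ 2] grows at most exponentially: the singular term
   of the equation only damps it. *)
Lemma radial_ode_unique (f f1 : R -> R) : radial_ode f f1 ->
  f r @[r --> 0^'+] --> (0 : R) -> forall r, 0 < r -> f r = 0.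
Proof.
move=> ode f0 r r0.
have [d1 d10 h1] := radial_ode_derive_le ode f0.
have [d2 d20 h2] : exists2 d : R, 0 < d & forall r, 0 < r < d -> - f1 r <= `|c| * r.
  apply: radial_ode_derive_le (radial_ode_opp ode) _.
  by rewrite -[X in _ --> X]oppr0; apply: cvgN.
(* The derivative of [E] is [2 * (1 + c) * f * f1] minus a nonnegative damping term, and
   [2 * |f * f1|] is at most [E]; hence the growth rate [K]. *)
pose K := `|1 + c|.
pose E t := f t ^+ 2 + f1 t ^+ 2.
have E0 t : 0 <= E t by rewrite addr_ge0 ?sqr_ge0.
have dec x : 0 < x -> x <= r -> E r * expR (- K * r) <= E x * expR (- K * x).
  move=> x0 xr.
  apply: (@derive_nonincreasing _ (fun t => E t * expR (- K * t))
    (fun t => (2 * (1 + c) * (f t * f1 t) - 2 * n%:R * (f1 t ^+ 2 / t) - K * E t)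
              * expR (- K * t)) x r) => // t /andP[xt tr].
    have t0 : 0 < t by lra.
    have [h h'] := ode t t0.
    have he : is_derive t (1 : R) (fun s => expR (- K * s)) (- K * expR (- K * t)).
      by apply: is_derive_scalef => s; exact: is_derive_expR.
    by rewrite /E; der_eq; field; rewrite gt_eqF.
  have t0 : 0 < t by lra.
  apply: mulr_le0_ge0; last exact: expR_ge0.
  have p1 : 0 <= 2 * n%:R * (f1 t ^+ 2 / t).
    by rewrite mulr_ge0 ?divr_ge0 ?sqr_ge0 ?(ltW t0)// mulr_ge0.
  have p2 : 2 * (1 + c) * (f t * f1 t) <= K * E t.
    have -> : 2 * (1 + c) * (f t * f1 t) = (1 + c) * (2 * f t * f1 t) by ring.
    apply: le_trans (ler_norm _) _; rewrite normrM ler_wpM2l//.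
    rewrite ler_norml /E; apply/andP; split.
      by have := sqr_ge0 (f t + f1 t); lra.
    by have := sqr_ge0 (f t - f1 t); lra.
  lra.
suff : E r * expR (- K * r) <= 0.
  rewrite pmulr_lle0 ?expR_gt0// => Er.
  have : f r ^+ 2 <= 0 by apply: le_trans Er; rewrite lerDl sqr_ge0.
  by move=> h; apply/eqP; rewrite -sqrf_eq0 eq_le h sqr_ge0.
apply/ler_addgt0Pr => e e0; rewrite add0r.
have cvgE : (1 + `|c| ^+ 2 * t) * t @[t --> 0^'+] --> (0 : R).
  apply: cvg_at_right_filter.
  have h : is_derive (0 : R) (1 : R) (fun t => (1 + `|c| ^+ 2 * t) * t) 1.
    by der_eq; ring.
  by have := is_derive_cvg h; rewrite mulr0.
(* By the linear bounds on [f1], this expression dominates the energy near the origin, so the energy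
   tends to 0 there. *)
have f2 : f t ^+ 2 + (`|c| * t) ^+ 2 @[t --> 0^'+] --> (0 : R).
  rewrite -[X in _ --> X](_ : 0 ^+ 2 + (`|c| * 0) ^+ 2 = 0); last first.
    by rewrite mulr0 expr0n/= addr0.
  have ct : `|c| * t @[t --> 0^'+] --> `|c| * 0.
    by apply: cvgM; [exact: cvg_cst | exact: cvg_at_right_filter cvg_id].
  by apply: cvgD; rewrite !expr2; apply: cvgM.
have /cvgrPdist_le/(_ e e0) [d3 /= d30 h3] := f2.
pose x := Num.min (Num.min d1 d2) (Num.min d3 r) / 2.
have x0 : 0 < Num.min (Num.min d1 d2) (Num.min d3 r) by rewrite !lt_min d10 d20 d30 r0.
have [l1 l2 l3 l4] : [/\ x < d1, x < d2, x < d3 & x < r].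
  have : x < Num.min (Num.min d1 d2) (Num.min d3 r) by rewrite /x; lra.
  by rewrite !lt_min => /andP[/andP[-> ->] /andP[-> ->]].
have {}x0 : 0 < x by rewrite divr_gt0.
apply: le_trans (dec x x0 (ltW l4)) _.
apply: (@le_trans _ _ (E x)).
  rewrite -[leRHS]mulr1 ler_wpM2l// -expR0 ler_expR.
  by rewrite mulNr oppr_le0; apply: mulr_ge0; [exact: normr_ge0 | exact: ltW].
have := h3 x; rewrite /= sub0r normrN gtr0_norm// => /(_ l3 x0).
rewrite sub0r normrN => /(le_trans (ler_norm _)); apply: le_trans.
rewrite /E lerD2l -[f1 x ^+ 2]real_normK ?num_real// ler_sqr ?nnegrE//; last first.
  by apply: mulr_ge0; [exact: normr_ge0 | exact: ltW].
rewrite ler_norml; have := h1 x; have := h2 x; rewrite x0 l1 l2 => /(_ isT) + /(_ isT).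
by lra.
Qed.

End RadialODE.

(** * Separation of variables *)

Section Separation.
Context {R : realType}.
Implicit Types (g : R * R -> R) (p : R * R).

(** The discriminant of the characteristic polynomial, that is, the squared difference of the
    eigenvalues. *)
Definition disc p : R := p.1 ^+ 2 - 4 * p.2.

Lemma U_disc p : U p <-> 0 < disc p.
Proof. by rewrite /U /disc /= subr_gt0. Qed.

Lemma has_grad_disc p : has_grad disc p (2 * p.1) (- 4).
Proof.
have h1 := has_grad_fst p; have h2 := has_grad_snd p.
have h : has_grad (fun q : R * R => q.1 * q.1 + -4 * q.2) p (2 * p.1) (- 4).
  apply: has_grad_eq (has_gradD (has_gradM h1 h1) (has_gradM (has_grad_cst (-4) p) h2)) _ _.
    by ring.
  by ring.
have -> // : disc = (fun q : R * R => q.1 * q.1 + -4 * q.2).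
by apply/funext => q; rewrite /disc expr2 mulNr.
Qed.

Lemma near_U p : U p -> \forall q \near p, U q.
Proof.
move=> /U_disc p0; have := has_grad_continuous (has_grad_disc p).
move=> /(_ [set x | 0 < x]) h.
have : \forall q \near p, 0 < disc q by apply: h; exact: lt_nbhsr.
by apply: filterS => q /U_disc.
Qed.

Lemma has_grad_sep (A B : R -> R) p (dA dB : R) :
  is_derive p.1 1 A dA -> is_derive (disc p) 1 B dB ->
  has_grad (fun q => A q.1 + B (disc q)) p (dA + 2 * p.1 * dB) (- 4 * dB).
Proof.
move=> hA hB.
apply: has_grad_eq (has_gradD (has_grad_comp (has_grad_fst p) hA)
  (has_grad_comp (has_grad_disc p) hB)) _ _; ring.
Qed.

Section Derivatives.
Variables (A A1 A2 B B1 B2 : R -> R) (g : R * R -> R).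
Hypothesis hA : forall s : R, is_derive s 1 A (A1 s).
Hypothesis hA1 : forall s : R, is_derive s 1 A1 (A2 s).
Hypothesis hB : forall x : R, 0 < x -> is_derive x 1 B (B1 x).
Hypothesis hB1 : forall x : R, 0 < x -> is_derive x 1 B1 (B2 x).
Hypothesis gE : forall p, U p -> g p = A p.1 + B (disc p).

Lemma has_grad_on_U F G p u v : (forall q, U q -> G q = F q) -> U p ->
  has_grad F p u v -> has_grad G p u v.
Proof.
move=> GF Up; apply: near_has_grad.
by apply: filterS (near_U Up) => q /GF.
Qed.

Lemma sep_grad p : U p ->
  has_grad g p (A1 p.1 + 2 * p.1 * B1 (disc p)) (- 4 * B1 (disc p)).
Proof.
move=> Up; apply: (has_grad_on_U gE Up).
exact: has_grad_sep (hA _) (hB (proj1 (U_disc p) Up)).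
Qed.

Lemma sep_d1 p : U p -> d1 g p = A1 p.1 + 2 * p.1 * B1 (disc p).
Proof. by move=> /sep_grad /has_grad_d1. Qed.

Lemma sep_d2 p : U p -> d2 g p = - 4 * B1 (disc p).
Proof. by move=> /sep_grad /has_grad_d2. Qed.

Lemma sep_grad_d1 p : U p -> has_grad (d1 g) p
  (A2 p.1 + 2 * B1 (disc p) + 4 * p.1 ^+ 2 * B2 (disc p))
  (- 8 * p.1 * B2 (disc p)).
Proof.
move=> Up; apply: (has_grad_on_U sep_d1 Up).
have Bp : is_derive (disc p) 1 B1 (B2 (disc p)) by apply: hB1; exact/U_disc.
have h1 := has_grad_comp (has_grad_fst p) (hA1 p.1).
have h2 := has_grad_comp (has_grad_disc p) Bp.
apply: has_grad_eq (has_gradD h1 (has_gradM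
  (has_gradM (has_grad_cst 2 p) (has_grad_fst p)) h2)) _ _; ring.
Qed.

Lemma sep_grad_d2 p : U p -> has_grad (d2 g) p
  (- 8 * p.1 * B2 (disc p)) (16 * B2 (disc p)).
Proof.
move=> Up; apply: (has_grad_on_U sep_d2 Up).
have Bp : is_derive (disc p) 1 B1 (B2 (disc p)) by apply: hB1; exact/U_disc.
have h2 := has_grad_comp (has_grad_disc p) Bp.
apply: has_grad_eq (has_gradM (has_grad_cst (-4) p) h2) _ _; ring.
Qed.

(** After [p.2] is expressed through [p.1] and [disc p], the terms in [p.1 ^+ 2 * B2 (disc p)]
    cancel and the two variables separate. *)
Lemma sep_first_equation (beta c : R) p : U p ->
  d1 (d1 g) p - p.2 * d2 (d2 g) p = beta / 2 * d2 g p + c * g p <->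
  A2 p.1 + 4 * disc p * B2 (disc p) + (2 + 2 * beta) * B1 (disc p)
    = c * (A p.1 + B (disc p)).
Proof.
move=> Up; rewrite (has_grad_d1 (sep_grad_d1 Up)) (has_grad_d2 (sep_grad_d2 Up)).
rewrite (sep_d2 Up) (gE Up).
have -> : p.2 = (p.1 ^+ 2 - disc p) / 4 by rewrite /disc; field.
by split => /eqP h; apply/eqP; move: h; rewrite -subr_eq0 => /eqP h;
  rewrite -subr_eq0 -h; apply/eqP; field.
Qed.

Lemma sep_second_equation p : U p ->
  2 * d2 (d1 g) p + p.1 * d2 (d2 g) p = 0.
Proof.
move=> Up; rewrite (has_grad_d2 (sep_grad_d1 Up)) (has_grad_d2 (sep_grad_d2 Up)).
by ring.
Qed.

(** The derivatives [A3] and [B3] provide the continuity of [A2] and [B2], and thus of the second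
    partial derivatives. *)
Lemma sep_C2 (A3 B3 : R -> R) :
  (forall s : R, is_derive s 1 A2 (A3 s)) ->
  (forall x : R, 0 < x -> is_derive x 1 B2 (B3 x)) -> C2_on (@U R) g.
Proof.
move=> hA2 hB2.
have d11 q : U q -> d1 (d1 g) q = A2 q.1 + 2 * B1 (disc q) + 4 * q.1 ^+ 2 * B2 (disc q).
  by move=> /sep_grad_d1 /has_grad_d1.
have d21 q : U q -> d2 (d1 g) q = - 8 * q.1 * B2 (disc q).
  by move=> /sep_grad_d1 /has_grad_d2.
have d12 q : U q -> d1 (d2 g) q = - 8 * q.1 * B2 (disc q).
  by move=> /sep_grad_d2 /has_grad_d1.
have d22 q : U q -> d2 (d2 g) q = 16 * B2 (disc q).
  by move=> /sep_grad_d2 /has_grad_d2.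
have grads p : U p -> [/\ exists u v, has_grad (fun q => A2 q.1) p u v,
    exists u v, has_grad (fun q => B1 (disc q)) p u v &
    exists u v, has_grad (fun q => B2 (disc q)) p u v].
  move=> /U_disc p0; split; do 2 eexists.
  - exact: has_grad_comp (has_grad_fst p) (hA2 _).
  - exact: has_grad_comp (has_grad_disc p) (hB1 p0).
  - exact: has_grad_comp (has_grad_disc p) (hB2 _ p0).
split=> p Up; have [[ua [va ga]] [ub [vb gb]] [uc [vc gc]]] := grads p Up.
- split.
  + exact: has_grad_differentiable (sep_grad Up).
  + exact: has_grad_continuous (sep_grad_d1 Up).
  + exact: has_grad_continuous (sep_grad_d2 Up).
- split.
  + exact: has_grad_differentiable (sep_grad_d1 Up).
  + apply: has_grad_continuous (has_grad_on_U d11 Up _).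
    apply: has_gradD (has_gradD ga (has_gradM (has_grad_cst 2 p) gb)) _.
    apply: has_gradM (has_gradM (has_grad_cst 4 p) _) gc.
    by under eq_fun do rewrite expr2; exact: has_gradM (has_grad_fst p) (has_grad_fst p).
  + apply: has_grad_continuous (has_grad_on_U d21 Up _).
    exact: has_gradM (has_gradM (has_grad_cst (-8) p) (has_grad_fst p)) gc.
- split.
  + exact: has_grad_differentiable (sep_grad_d2 Up).
  + apply: has_grad_continuous (has_grad_on_U d12 Up _).
    exact: has_gradM (has_gradM (has_grad_cst (-8) p) (has_grad_fst p)) gc.
  + apply: has_grad_continuous (has_grad_on_U d22 Up _).
    exact: has_gradM (has_grad_cst 16 p) gc.
Qed.

End Derivatives.

(* The second equation says that the derivative of [g] along the curves of
   constant [disc] does not depend on [sigma_2]. *)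
Lemma separation g : C2_on (@U R) g ->
  (forall p, U p -> 2 * d2 (d1 g) p + p.1 * d2 (d2 g) p = 0) ->
  exists A A1 A2 B B1 B2 : R -> R,
    [/\ forall s : R, is_derive s 1 A (A1 s) /\ is_derive s 1 A1 (A2 s),
        forall x : R, 0 < x -> is_derive x 1 B (B1 x) /\ is_derive x 1 B1 (B2 x)
      & forall p, U p -> g p = A p.1 + B (disc p)].
Proof.
move=> [C1 C1d1 C1d2] eq2.
(* In the coordinates [s = sigma_1] and [x = disc], the value of [sigma_2] is [y s x]. *)
pose y (s x : R) : R := (s ^+ 2 - x) / 4.
have discy s x : disc (s, y s x) = x by rewrite /disc /y /=; field.
have Uy s x : 0 < x -> U (s, y s x) by move=> x0; apply/U_disc; rewrite discy.
have gradg p : U p -> has_grad g p (d1 g p) (d2 g p).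
  by move=> /C1[h _ _]; exact: differentiable_has_grad.
have gradd1 p : U p -> has_grad (d1 g) p (d1 (d1 g) p) (d2 (d1 g) p).
  by move=> /C1d1[h _ _]; exact: differentiable_has_grad.
have gradd2 p : U p -> has_grad (d2 g) p (d1 (d2 g) p) (d2 (d2 g) p).
  by move=> /C1d2[h _ _]; exact: differentiable_has_grad.
(* [P] is the derivative of [g] along a curve of constant [disc], whose slope is [s / 2]; the second
   equation says that its derivative in [sigma_2] vanishes. *)
have [P [P1 [gradP PE]]] : exists P P1 : R * R -> R,
    (forall p, U p -> has_grad P p (P1 p) 0) /\
    (forall p, P p = d1 g p + 2^-1 * p.1 * d2 g p).
  exists (fun p => d1 g p + 2^-1 * p.1 * d2 g p),
    (fun p => d1 (d1 g) p + 2^-1 * (d2 g p + p.1 * d1 (d2 g) p)).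
  split=> // p Up; have h := eq2 p Up.
  apply: has_grad_eq (has_gradD (gradd1 p Up) (has_gradM (has_gradM
    (has_grad_cst 2^-1 p) (has_grad_fst p)) (gradd2 p Up))) _ _.
    by move: (d1 (d1 g) p) (d1 (d2 g) p) (d2 g p) => u v w; ring.
  move: h; move: (d2 (d1 g) p) (d2 (d2 g) p) (d2 g p) => u v w h.
  have -> : u = - (2^-1 * p.1 * v) by lra.
  by ring.
have dys s x : is_derive s (1 : R) (fun t => y t x) (s / 2).
  by rewrite /y; der_eq; rewrite expr1; field.
have dyx s x : is_derive x (1 : R) (fun t => y s t) (- 4^-1).
  by rewrite /y; der_eq; field.
have Pconst s x : 0 < x -> P (s, y s x) = P (s, y s 1).
  move=> x0.
  apply: (@derive0_const _ (fun t => 0 < t) (fun t => P (s, y s t))) => //.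
    by move=> u v t u0 _ /andP[ut _]; exact: lt_le_trans ut.
  move=> t t0; have := has_grad_curve (is_derive_cstf t s) (dyx s t) (gradP _ (Uy s t t0)).
  by move=> h; apply: is_derive_eq h _; ring.
have dgs s x : 0 < x -> is_derive s (1 : R) (fun t => g (t, y t x)) (P (s, y s x)).
  move=> x0; have := has_grad_curve (is_derive_idf s) (dys s x) (gradg _ (Uy s x x0)).
  move=> h; apply: is_derive_eq h _; rewrite PE /=.
  by move: (d1 g _) (d2 g _) => u v; ring.
(* [A] is read off the curve [disc = 1], normalized to vanish at 0, and [B] off the axis
   [sigma_1 = 0], where [sigma_2] is [- x / 4]. *)
exists (fun s => g (s, y s 1) - g (0, y 0 1)), (fun s => P (s, y s 1)),
  (fun s => P1 (s, y s 1)), (fun x => g (0, y 0 x)),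
  (fun x => - 4^-1 * d2 g (0, y 0 x)),
  (fun x => 16^-1 * d2 (d2 g) (0, y 0 x)).
split.
- move=> s; split.
    by have h := dgs s 1 ltr01; der_eq; ring.
  have := has_grad_curve (is_derive_idf s) (dys s 1) (gradP _ (Uy s 1 ltr01)).
  by move=> h; apply: is_derive_eq h _; ring.
- move=> x x0; split.
    have := has_grad_curve (is_derive_cstf x 0) (dyx 0 x) (gradg _ (Uy 0 x x0)).
    move=> h; apply: is_derive_eq h _.
    by move: (d1 g _) (d2 g _) => u v; ring.
  have h := has_grad_curve (is_derive_cstf x 0) (dyx 0 x) (gradd2 _ (Uy 0 x x0)).
  by der_eq; move: (d1 (d2 g) _) (d2 (d2 g) _) (d2 g _) => u v w; field.
- move=> p /U_disc p0.
  have pE : p = (p.1, y p.1 (disc p)).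
    by rewrite [LHS]surjective_pairing; congr pair; rewrite /y /disc; field.
  (* Along the curves of [disc] equal to [disc p] and to 1, [g] has the same derivative in [s], so
     the difference keeps its value at [s = 0]. *)
  have e : g (p.1, y p.1 (disc p)) - g (p.1, y p.1 1)
      = g (0, y 0 (disc p)) - g (0, y 0 1).
    apply: (@is_derive_0_is_cst _ (fun s => g (s, y s (disc p)) - g (s, y s 1))) => s.
    have h := dgs s (disc p) p0; have h' := dgs s 1 ltr01.
    by der_eq; rewrite (Pconst s _ p0) subrr.
  by rewrite {1}pE; lra.
Qed.

End Separation.

(** * Boundary values and classification *)

Section Boundary.
Context {R : realType}.
Implicit Types (g F : R * R -> R) (p : R * R).

(** Lowering [sigma_2] increases [disc], so points of [U] lie arbitrarily close below [p]. *)
Lemma closure_U p : 0 <= disc p -> closure (@U R) p.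
Proof.
move=> p0 B [[e1 e2] /= [h1 [e /= e0 h2]] hB].
exists (p.1, p.2 - e / 2); split.
  by apply/U_disc; move: p0; rewrite /disc /=; lra.
apply: hB; split => /=; first exact: nbhs_singleton h1.
by apply: h2; rewrite /= opprB addrC subrK gtr0_norm; lra.
Qed.

Lemma cvg_U g F p : {for p, continuous F} -> (forall q, U q -> g q = F q) ->
  g @ within (@U R) (nbhs p) --> F p.
Proof.
move=> cF gF.
have h : F @ within (@U R) (nbhs p) --> F p by apply: cvg_within_filter.
apply: cvg_trans h; apply: near_eq_cvg; rewrite near_withinE.
by apply: nearW => q Uq; rewrite gF.
Qed.

Lemma extUE g F p : {for p, continuous F} -> (forall q, U q -> g q = F q) ->
  0 <= disc p -> extU g p = F p.
Proof.
move=> cF gF p0; have pf := within_nbhs_proper (closure_U p0).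
by apply: cvg_lim => //; exact: cvg_U.
Qed.

(** The points [(0, - (r ^+ 2 / 4))] lie in [U] and have [disc] equal to [r ^+ 2]: the limit at the
    origin becomes one in the radial variable. *)
Lemma cvg_U_axis g (l : R) : g @ within (@U R) (nbhs ((0 : R), (0 : R))) --> l ->
  g (0, - (r ^+ 2 / 4)) @[r --> (0 : R)^'+] --> l.
Proof.
move=> gl.
suff h : ((0 : R), - (r ^+ 2 / 4)) @[r --> (0 : R)^'+]
    --> within (@U R) (nbhs ((0 : R), (0 : R))).
  exact: (cvg_comp _ _ h gl).
move=> P [[P1 P2] /= [h1 h2] hP].
have dy : is_derive (0 : R) (1 : R) (fun r : R => - (r ^+ 2 / 4)) 0.
  by der_eq; rewrite expr1; field.
have cy := is_derive_cvg dy; rewrite /= expr0n/= mul0r oppr0 in cy.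
have {}h2 : \forall r \near (0 : R)^'+, P2 (- (r ^+ 2 / 4)).
  by apply: cvg_at_right_filter cy _ h2.
have : \forall r \near (0 : R)^'+, P (0, - (r ^+ 2 / 4)).
  near=> r; have r0 : 0 < r by near: r; exact: nbhs_right_gt.
  apply: hP; last by rewrite /U /= mulrN expr0n/= oppr_lt0 mulr_gt0// divr_gt0// exprn_gt0.
  by split => /=; [exact: nbhs_singleton h1 | near: r].
by [].
Unshelve. all: by end_near. Qed.

End Boundary.

(** * From the system to explicit forms, and back *)

Section Solutions.
Context {R : realType}.
Variables (beta : nat) (a b : R).
Hypothesis beta0 : (0 < beta)%N.
Let c : R := b ^+ 2 - 4 * a.

Section Regular.
Variables (A A1 A2 A3 B B1 B2 B3 : R -> R) (g : R * R -> R).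
Hypothesis hA : forall s : R, is_derive s 1 A (A1 s).
Hypothesis hA1 : forall s : R, is_derive s 1 A1 (A2 s).
Hypothesis hA2 : forall s : R, is_derive s 1 A2 (A3 s).
Hypothesis hB : forall x : R, is_derive x 1 B (B1 x).
Hypothesis hB1 : forall x : R, is_derive x 1 B1 (B2 x).
Hypothesis hB2 : forall x : R, is_derive x 1 B2 (B3 x).
Hypothesis gE : forall p, U p -> g p = A p.1 + B (disc p).

Lemma regular_continuous p : {for p, continuous (fun q => A q.1 + B (disc q))}.
Proof. exact: has_grad_continuous (has_grad_sep (hA _) (hB _)). Qed.

Lemma regular_extU p : 0 <= disc p -> extU g p = A p.1 + B (disc p).
Proof. by move=> p0; rewrite (extUE (@regular_continuous p) gE p0). Qed.

Lemma regular_extU00 : extU g (0, 0) = A 0 + B 0.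
Proof. by rewrite regular_extU /disc /= ?expr0n/= ?mulr0 ?subr0. Qed.

(** On the axis [sigma_2 = 0], [disc] is [s ^+ 2], whose derivative at 0 vanishes, so [B] does not
    contribute. *)
Lemma regular_derive_extU : is_derive (0 : R) 1 (fun s : R => extU g (s, 0)) (A1 0).
Proof.
have -> : (fun s : R => extU g (s, 0)) = (fun s => A s + B (s ^+ 2)).
  by apply/funext => s; rewrite regular_extU /disc /= mulr0 subr0// sqr_ge0.
have h0 := hA 0.
have h : is_derive (0 : R) (1 : R) (fun s : R => s ^+ 2) 0 by der_eq; ring.
by apply: is_derive_eq (is_derive_addf h0 (is_derive_compf h (hB _))) _; ring.
Qed.

Lemma regular_solution :
  (forall s x, 0 < x -> A2 s + 4 * x * B2 x + (2 + 2 * beta%:R) * B1 x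
                        = c * (A s + B x)) ->
  A 0 + B 0 = 1 -> A1 0 = - b -> solution beta a b g.
Proof.
move=> pde g0 g1; have hB' x (_ : 0 < x) := hB x; have hB1' x (_ : 0 < x) := hB1 x.
split.
- exact: (sep_C2 hA hA1 hB' hB1' gE hA2 (fun x _ => hB2 x)).
- move=> p Up; split; last exact: (sep_second_equation hA hA1 hB' hB1' gE Up).
  apply/(sep_first_equation hA hA1 hB' hB1' gE _ _ Up).
  by apply: pde; exact/U_disc.
- apply/cvg_ex; exists (A 0 + B (disc (0, 0))).
  exact: (cvg_U (@regular_continuous (0, 0)) gE).
- by rewrite regular_extU00.
- by rewrite -g1; exact: regular_derive_extU.
Qed.

Lemma solution_initial : solution beta a b g -> A 0 + B 0 = 1 /\ A1 0 = - b.
Proof.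
move=> [_ _ _ g0 g1]; rewrite -regular_extU00; split=> //.
exact: is_derive_unique regular_derive_extU g1.
Qed.

End Regular.

(* The half-integer power singularity (logarithmic for beta = 1) at [x = 0] is
   excluded by the limit along [x = r ^+ 2], where the equation becomes radial. *)
Lemma disc_ode_unique (B B1 B2 : R -> R) :
  (forall x : R, 0 < x -> is_derive x 1 B (B1 x) /\ is_derive x 1 B1 (B2 x)) ->
  (forall x, 0 < x -> 4 * x * B2 x + (2 + 2 * beta%:R) * B1 x = c * B x) ->
  B (r ^+ 2) @[r --> (0 : R)^'+] --> (0 : R) ->
  forall x, 0 < x -> B x = 0.
Proof.
move=> hB ode B0 x x0.
have sx : 0 < Num.sqrt x by rewrite sqrtr_gt0.
rewrite -[x]sqr_sqrtr ?ltW//.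
apply: (@radial_ode_unique _ beta c beta0 (fun r => B (r ^+ 2))
  (fun r => 2 * r * B1 (r ^+ 2))) => // r r0.
have r20 : 0 < r ^+ 2 by exact: exprn_gt0.
have [h h1] := hB _ r20.
have hr : is_derive r (1 : R) (fun r => r ^+ 2) (2 * r) by der_eq; rewrite expr1; ring.
have k := is_derive_compf hr h; have k1 := is_derive_compf hr h1.
split; first by apply: is_derive_eq k _; ring.
der_eq; rewrite -(ode _ r20); field; by rewrite gt_eqF.
Qed.

Let p : R := (beta%:R + 1) / 2.

Let p1 : 1 <= p.
Proof. by have : (1 : R) <= beta%:R; [rewrite ler1n | rewrite /p; lra]. Qed.

(** The [n]-th derivative in [x] of [l * dpsi 0 p (c * x)]; [c ^+ n] comes from the chain rule. *)
Definition psi_chain (n : nat) (l x : R) : R := l * (c ^+ n * dpsi n p (c * x)).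

Lemma is_derive_psi_chain n (l x : R) :
  is_derive x 1 (psi_chain n l) (psi_chain n.+1 l x).
Proof.
have h : is_derive x (1 : R) (fun x => dpsi n p (c * x)) (c * dpsi n.+1 p (c * x)).
  by apply: is_derive_scalef => y; exact: is_derive_dpsi.
by rewrite /psi_chain; der_eq; rewrite exprS; ring.
Qed.

Lemma psi_chain_ode (l x : R) :
  4 * x * psi_chain 2 l x + (2 + 2 * beta%:R) * psi_chain 1 l x
    = c * psi_chain 0 l x.
Proof.
by rewrite /psi_chain -(psi_ode (c * x) p1) /p; field.
Qed.

Lemma psi_chain0 l : psi_chain 0 l 0 = l.
Proof. by rewrite /psi_chain mulr0 psi0 !mulr1. Qed.

(** In [eqn] the variables [s] and [x] are independent, whence the separation constant
    [k = A2 0 - c * A 0]. The limit [l] is that of [g] at the origin minus [A 0]. *)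
Lemma solution_separated g : solution beta a b g ->
  exists A A1 A2 B B1 B2 : R -> R, exists k l : R,
    [/\ forall s : R, is_derive s 1 A (A1 s) /\ is_derive s 1 A1 (A2 s),
        forall s, A2 s = c * A s + k,
        forall x : R, 0 < x -> [/\ is_derive x 1 B (B1 x), is_derive x 1 B1 (B2 x)
          & 4 * x * B2 x + (2 + 2 * beta%:R) * B1 x = c * B x - k],
        B (r ^+ 2) @[r --> (0 : R)^'+] --> l
      & forall q, U q -> g q = A q.1 + B (disc q)].
Proof.
move=> [C2g pde cvgg _ _].
have [A [A1 [A2 [B [B1 [B2 [hA hB gE]]]]]]] := separation C2g (fun p Up => proj2 (pde p Up)).
have eqn s x : 0 < x ->
    A2 s + 4 * x * B2 x + (2 + 2 * beta%:R) * B1 x = c * (A s + B x).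
  move=> x0; have discE : disc (s, (s ^+ 2 - x) / 4) = x by rewrite /disc /=; field.
  have Up : U (s, (s ^+ 2 - x) / 4) by apply/U_disc; rewrite discE.
  have := (sep_first_equation (fun s => proj1 (hA s)) (fun s => proj2 (hA s))
    (fun x x0 => proj1 (hB x x0)) (fun x x0 => proj2 (hB x x0)) gE beta%:R c Up).1.
  by rewrite discE; apply; exact: (pde _ Up).1.
have kE s : A2 s - c * A s = A2 0 - c * A 0.
  have := eqn s 1 ltr01; have := eqn 0 1 ltr01; lra.
pose l := lim (g @ within (@U R) (nbhs ((0 : R), (0 : R)))) - A 0.
exists A, A1, A2, B, B1, B2, (A2 0 - c * A 0), l; split => //.
- by move=> s; have := kE s; lra.
- move=> x x0; have [h h1] := hB x x0; split=> //.
  by have := eqn 0 x x0; lra.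
- have h := cvg_U_axis cvgg.
  have {}h : g (0, - (r ^+ 2 / 4)) - A 0 @[r --> 0^'+] --> l.
    by apply: cvgB h _; exact: cvg_cst.
  apply: cvg_trans h; apply: near_eq_cvg; near=> r.
  have r0 : 0 < r by near: r; exact: nbhs_right_gt.
  have discE : disc (0, - (r ^+ 2 / 4)) = r ^+ 2 by rewrite /disc /=; field.
  rewrite gE; last by apply/U_disc; rewrite discE exprn_gt0.
  by rewrite discE /=; ring.
Unshelve. all: by end_near. Qed.

Lemma cvg_sqr_at_right (B : R -> R) (d : R) : is_derive (0 : R) 1 B d ->
  B (r ^+ 2) @[r --> (0 : R)^'+] --> B 0.
Proof.
move=> h; have h2 : is_derive (0 : R) (1 : R) (fun s : R => s ^+ 2) 0 by der_eq; ring.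
have h' : is_derive ((fun s : R => s ^+ 2) 0) 1 B d by rewrite expr0n.
have := is_derive_cvg (is_derive_compf h2 h'); rewrite expr0n/=.
exact: cvg_at_right_filter.
Qed.

(** The constant [k / c] is moved from [B] to [A], which makes both equations homogeneous.
    Subtracting from the shifted [B] the regular solution with the same limit [l - k / c] leaves a
    solution tending to 0, which vanishes by [disc_ode_unique]. *)
Lemma solution_form g : c != 0 -> solution beta a b g ->
  exists A A1 A2 : R -> R, exists l : R,
    [/\ forall s : R, is_derive s 1 A (A1 s) /\ is_derive s 1 A1 (A2 s),
        forall s, A2 s = c * A s
      & forall q, U q -> g q = A q.1 + psi_chain 0 l (disc q)].
Proof.
move=> c0 /solution_separated
  [A [A1 [A2 [B [B1 [B2 [k [l [hA hA2 hB Bl gE]]]]]]]]].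
pose l' := l - k / c.
exists (fun s => A s + k / c), A1, A2, l'; split.
- move=> s; have [h h1] := hA s; split=> //.
  by der_eq; ring.
- by move=> s; rewrite hA2; field.
- move=> q Uq; rewrite gE//.
  suff : B (disc q) - k / c - psi_chain 0 l' (disc q) = 0 by lra.
  apply: (@disc_ode_unique (fun x => B x - k / c - psi_chain 0 l' x)
    (fun x => B1 x - psi_chain 1 l' x) (fun x => B2 x - psi_chain 2 l' x)).
  + move=> x x0; have [h h1 _] := hB x x0.
    have f0 := is_derive_psi_chain 0 l' x; have f1 := is_derive_psi_chain 1 l' x.
    by split; der_eq; ring.
  + move=> x x0; have [_ _ e] := hB x x0.
    have e' := psi_chain_ode l' x.
    have -> : c * (B x - k / c - psi_chain 0 l' x)
        = (c * B x - k) - c * psi_chain 0 l' x by field.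
    by rewrite -e -e'; ring.
  + rewrite -[X in _ --> X](_ : l - k / c - psi_chain 0 l' 0 = 0); last first.
      by rewrite psi_chain0 subrr.
    apply: cvgB; first by apply: cvgB => //; exact: cvg_cst.
    exact: cvg_sqr_at_right (is_derive_psi_chain 0 l' 0).
  + exact/U_disc.
Qed.

(** Here [A] is quadratic, and the equation for [B] has the linear particular solution of slope
    [- k / (2 + 2 * beta%:R)]; what remains of [B] after removing it and [l] solves the homogeneous
    equation and tends to 0. *)
Lemma solution_form0 g : c = 0 -> solution beta a b g ->
  exists l m k : R, forall q, U q ->
    g q = l + m * q.1 + k / 2 * q.1 ^+ 2 - k / (2 + 2 * beta%:R) * disc q.
Proof.
move=> c0 /solution_separated
  [A [A1 [A2 [B [B1 [B2 [k [l [hA hA2 hB Bl gE]]]]]]]]].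
have AE := ode_quadratic (fun s => proj1 (hA s)) (fun s => proj2 (hA s))
  (fun s => etrans (hA2 s) (etrans (congr1 (fun z => z * A s + k) c0)
     (etrans (congr1 (fun z => z + k) (mul0r _)) (add0r k)))).
exists (A 0 + l), (A1 0), k => q Uq; rewrite gE// AE.
pose D := k / (2 + 2 * beta%:R).
have n0 : 2 + 2 * beta%:R != 0 :> R by rewrite lt0r_neq0// ltr_wpDr// mulr_ge0.
suff : B (disc q) - l + D * disc q = 0 by rewrite /D; lra.
apply: (@disc_ode_unique (fun x => B x - l + D * x) (fun x => B1 x + D) B2).
- by move=> x x0; have [h h1 _] := hB x x0; split; der_eq; ring.
- move=> x x0; have [_ _ e] := hB x x0; move: e; rewrite c0 !mul0r sub0r => e.
  have -> : 4 * x * B2 x + (2 + 2 * beta%:R) * (B1 x + D)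
    = 4 * x * B2 x + (2 + 2 * beta%:R) * B1 x + k by rewrite /D; field.
  by rewrite e addNr.
- rewrite -[X in _ --> X](_ : l - l + D * 0 = 0); last by ring.
  apply: cvgD; first by apply: cvgB => //; exact: cvg_cst.
  have h : is_derive (0 : R) (1 : R) (fun x => D * x) D by der_eq; ring.
  exact: cvg_sqr_at_right h.
- exact/U_disc.
Qed.

End Solutions.

(** * The three families *)

Section Matrices.
Context {R : realType}.
Variables (beta : nat).
Hypothesis hbeta : beta \in [:: 1; 2; 4]%N.

(** With diagonal [x], [y] and off-diagonal entry [q], the discriminant is [(x - y) ^+ 2] plus four
    times the squared norm of [q]. Hence [sigma theta] lies in the closure of [U], where [extU g] is
    known. *)
Lemma disc_hermitian2 (theta : 'M[coefs R beta]_2) :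
  hermitian2 theta -> 0 <= disc (sigma theta).
Proof.
move=> h; rewrite /disc /sigma /= det_mx2 (h ord0 ord_max).
rewrite /mxtrace !big_ord_recl big_ord0 addr0.
have -> : lift ord0 ord0 = ord_max :> 'I_2 by apply: val_inj.
have := h ord0 ord0; have := h ord_max ord_max.
move: (theta ord0 ord0) (theta ord_max ord_max) (theta ord0 ord_max) {h} => x y q.
have eqN (u : R) : u = - u -> u = 0 by lra.
case: beta hbeta x y q {theta} => [|[|[|[|[|n]]]]] //= _.
- move=> x y q _ _.
  have -> : (x + y) ^+ 2 - 4 * (x * y - q * q) = (x - y) ^+ 2 + (2 * q) ^+ 2 by ring.
  by rewrite addr_ge0 ?sqr_ge0.
- move=> [x x'] [y y'] [q q'] [] /eqN -> [] /eqN -> /=.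
  have -> : (x + y) ^+ 2 - 4 * (x * y - 0 * 0 - (q * q - q' * - q'))
     = (x - y) ^+ 2 + (2 * q) ^+ 2 + (2 * q') ^+ 2 by ring.
  by rewrite !addr_ge0 ?sqr_ge0.
- move=> [x x1 x2 x3] [y y1 y2 y3] [q q1 q2 q3].
  move=> [] /eqN -> /eqN -> /eqN -> [] /eqN -> /eqN -> /eqN -> /=.
  have -> : (x + y) ^+ 2 - 4 * (x * y - 0 * 0 - 0 * 0 - 0 * 0
      - (q * q - q1 * - q1 - q2 * - q2 - q3 * - q3))
    = (x - y) ^+ 2 + (2 * q) ^+ 2 + (2 * q1) ^+ 2 + (2 * q2) ^+ 2 + (2 * q3) ^+ 2 by ring.
  by rewrite !addr_ge0 ?sqr_ge0.
Qed.

(** Both sides say that [L] is positive with logarithm [- (b * s + ln G) / (4 * a)]. *)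
Lemma log_relation (a b s G L : R) : a != 0 -> 0 < G ->
  (0 < L /\ G = expR (- (4 * a * ln L) - b * s)) <->
  L = expR (- (b * s / (4 * a))) * G `^ (- (1 / (4 * a))).
Proof.
move=> a0 G0.
have -> : expR (- (b * s / (4 * a))) * G `^ (- (1 / (4 * a)))
    = expR (- ((b * s + ln G) / (4 * a))).
  by rewrite /powR gt_eqF// -expRD; congr expR; field.
split=> [[L0 ->]|->].
  by rewrite expRK -[LHS]lnK ?posrE//; congr expR; field.
split; first exact: expR_gt0.
by rewrite expRK -[LHS]lnK ?posrE//; congr expR; field.
Qed.

Lemma obtained_from_given_by (a b : R) (g : R * R -> R)
    (L F : 'M[coefs R beta]_2 -> R) : a != 0 ->
  (forall theta, hermitian2 theta -> let s := sigma theta in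
    F theta = expR (- (b * s.1 / (4 * a))) * extU g s `^ (- (1 / (4 * a)))) ->
  obtained_from a b g L <-> given_by g L F.
Proof.
move=> a0 FE; split=> h theta ht g0.
  by rewrite FE//; apply/log_relation => //; exact: h.
by apply/log_relation => //; rewrite h// FE.
Qed.

End Matrices.

(** * Polynomial, exponential and trigonometric families *)

Section Families.
Context {R : realType}.
Variables (beta : nat) (a b : R).
Hypothesis beta0 : (0 < beta)%N.
Let c : R := b ^+ 2 - 4 * a.

Section Polynomial.
Hypothesis c0 : c = 0.

Let A (l m k s : R) := l + m * s + k * s ^+ 2.

Let dA l m k s : is_derive s (1 : R) (A l m k) (m + 2 * k * s).
Proof. by rewrite /A; der_eq; rewrite expr1; ring. Qed.

Let dA1 (m k s : R) : is_derive s (1 : R) (fun s => m + 2 * k * s) (2 * k).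
Proof. by der_eq; ring. Qed.

Let dB (D s : R) : is_derive s (1 : R) (fun s => D * s) D.
Proof. by der_eq; ring. Qed.

Definition poly_family (C : R) (s : R * R) : R :=
  1 - b * s.1 + C * (beta%:R * s.1 ^+ 2 + 4 * s.2).

Let poly_familyE C s :
  poly_family C s = A 1 (- b) (C * (beta%:R + 1)) s.1 + - C * disc s.
Proof. by rewrite /poly_family /A /disc; ring. Qed.

Lemma poly_family_extU C g : (forall s, U s -> g s = poly_family C s) ->
  forall s, 0 <= disc s -> extU g s = poly_family C s.
Proof.
move=> gE s s0; rewrite poly_familyE.
apply: (regular_extU (dA _ _ _) (dB _) _ s0) => q Uq.
by rewrite gE// poly_familyE.
Qed.

Lemma poly_family_solution g : solution beta a b g <->
  exists C : R, forall s, U s -> g s = poly_family C s.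
Proof.
have n0 : 2 + 2 * beta%:R != 0 :> R by rewrite lt0r_neq0// ltr_wpDr// mulr_ge0.
split=> [sol|[C gE]].
  have [l [m [k gE]]] := solution_form0 beta0 c0 sol.
  have gE' q : U q -> g q = A l m (k / 2) q.1 + - (k / (2 + 2 * beta%:R)) * disc q.
    by move=> Uq; rewrite gE// /A; ring.
  have [] := solution_initial (dA _ _ _) (dB _) gE' sol.
  rewrite /A expr0n/= !mulr0 !addr0 => l1 mb.
  (* The coefficient of [disc] is [- C], which fixes [C]; the coefficient [k / 2] of the square is
     then [C * (beta%:R + 1)]. *)
  exists (k / (2 + 2 * beta%:R)) => s Us.
  by rewrite gE'// poly_familyE l1 mb /A; field.
apply: (regular_solution (dA 1 (- b) (C * (beta%:R + 1))) (dA1 _ _)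
  (fun s => is_derive_cstf s _) (dB (- C)) (fun s => is_derive_cstf s _)
  (fun s => is_derive_cstf s _)).
- by move=> s Us; rewrite gE// poly_familyE.
- by move=> s x x0; rewrite -/c c0; ring.
- by rewrite /A expr0n/=; ring.
- by ring.
Qed.

End Polynomial.

Let p : R := (beta%:R + 1) / 2.

(** The Bessel term in its entire form, which serves both signs of [c]. *)
Definition bessel_part (l : R) (s : R * R) : R := l * dpsi 0 p (c * disc s).

Let bessel_partE l s : bessel_part l s = psi_chain beta a b 0 l (disc s).
Proof. by rewrite /bessel_part /psi_chain mul1r. Qed.

Section Exponential.
Variable k : R.
Hypothesis k0 : k != 0.
Hypothesis ck : c = k ^+ 2.

(** Indexing by the order of differentiation yields the whole chain of derivatives from one rule. *)
Let A n (C1 C2 s : R) :=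
  C1 * k ^+ n * expR (k * s) + C2 * (- k) ^+ n * expR (- (k * s)).

Let dA n C1 C2 s : is_derive s (1 : R) (A n C1 C2) (A n.+1 C1 C2 s).
Proof.
have h1 : is_derive s (1 : R) (fun s => expR (k * s)) (k * expR (k * s)).
  by apply: is_derive_scalef => t; exact: is_derive_expR.
have h2 := is_derive_expR_scale k s.
by rewrite /A; der_eq; rewrite !exprS; ring.
Qed.

Definition exp_family (C1 C2 C3 : R) (s : R * R) : R :=
  C1 * expR (k * s.1) + C2 * expR (- (k * s.1)) + bessel_part C3 s.

Let exp_familyE C1 C2 C3 s :
  exp_family C1 C2 C3 s = A 0 C1 C2 s.1 + psi_chain beta a b 0 C3 (disc s).
Proof. by rewrite /exp_family /A bessel_partE; ring. Qed.

Lemma exp_family_extU C1 C2 C3 g :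
  (forall s, U s -> g s = exp_family C1 C2 C3 s) ->
  forall s, 0 <= disc s -> extU g s = exp_family C1 C2 C3 s.
Proof.
move=> gE s s0; rewrite exp_familyE.
apply: (regular_extU (dA 0 _ _) (is_derive_psi_chain a b beta0 0 _) _ s0) => q Uq.
by rewrite gE// exp_familyE.
Qed.

Lemma exp_family_solution g : solution beta a b g <->
  exists C1 C2 C3 : R, [/\ C1 + C2 + C3 = 1, C2 - C1 = b / k
    & forall s, U s -> g s = exp_family C1 C2 C3 s].
Proof.
have c0 : c != 0 by rewrite ck expf_neq0.
have init C1 C2 C3 : A 0 C1 C2 0 + psi_chain beta a b 0 C3 0 = C1 + C2 + C3.
  by rewrite /A psi_chain0 mulr0 oppr0 expR0; ring.
have init1 C1 C2 : A 1 C1 C2 0 = - k * (C2 - C1).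
  by rewrite /A mulr0 oppr0 expR0; ring.
split=> [sol|[C1 [C2 [C3 [e1 e2 gE]]]]].
  have [A' [A1 [A2 [l [hA hA2 gE]]]]] := solution_form beta0 c0 sol.
  have [C1 [C2 AE]] := ode_exp k0 (fun s => proj1 (hA s)) (fun s => proj2 (hA s))
    (fun s => etrans (hA2 s) (congr1 (fun z => z * A' s) ck)).
  have gE' q : U q -> g q = exp_family C1 C2 l q.
    by move=> Uq; rewrite gE// AE /exp_family bessel_partE.
  have gE2 q : U q -> g q = A 0 C1 C2 q.1 + psi_chain beta a b 0 l (disc q).
    by move=> Uq; rewrite gE'// exp_familyE.
  have [] := solution_initial (dA 0 C1 C2) (is_derive_psi_chain a b beta0 0 l) gE2 sol.
  rewrite init init1 => e1 e2; exists C1, C2, l; split=> //.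
  by rewrite -[b]opprK -e2; field.
apply: (regular_solution (dA 0 C1 C2) (dA 1 C1 C2) (dA 2 C1 C2)
  (is_derive_psi_chain a b beta0 0 C3) (is_derive_psi_chain a b beta0 1 C3)
  (is_derive_psi_chain a b beta0 2 C3)).
- by move=> s Us; rewrite gE// exp_familyE.
- move=> s x x0; rewrite -addrA (psi_chain_ode a b beta0) -/c [RHS]mulrDr.
  by congr (_ + _); rewrite /A ck; ring.
- by rewrite init.
- by rewrite init1 e2; field.
Qed.

End Exponential.

Section Trigonometric.
Variable k : R.
Hypothesis k0 : k != 0.
Hypothesis ck : c = - k ^+ 2.

Let A (C1 C2 s : R) := C1 * cos (k * s) + C2 * sin (k * s).

(** Differentiation preserves the form and only changes the coefficients, so this rule can be
    iterated. *)
Let dA C1 C2 s : is_derive s (1 : R) (A C1 C2) (A (k * C2) (- (k * C1)) s).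
Proof.
have h1 : is_derive s (1 : R) (fun s => sin (k * s)) (k * cos (k * s)).
  by apply: (@is_derive_scalef R sin cos) => t; exact: is_derive_sin.
have h2 : is_derive s (1 : R) (fun s => cos (k * s)) (k * - sin (k * s)).
  by apply: (@is_derive_scalef R cos (fun t => - sin t)) => t; exact: is_derive_cos.
by rewrite /A; der_eq; ring.
Qed.

Definition trig_family (l : R) (s : R * R) : R :=
  (1 - l) * cos (k * s.1) - b / k * sin (k * s.1) + bessel_part l s.

Let trig_familyE l s : trig_family l s
  = A (1 - l) (- (b / k)) s.1 + psi_chain beta a b 0 l (disc s).
Proof. by rewrite /trig_family /A bessel_partE mulNr. Qed.

Lemma trig_family_extU l g :
  (forall s, U s -> g s = trig_family l s) ->
  forall s, 0 <= disc s -> extU g s = trig_family l s.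
Proof.
move=> gE s s0; rewrite trig_familyE.
apply: (regular_extU (dA _ _) (is_derive_psi_chain a b beta0 0 _) _ s0) => q Uq.
by rewrite gE// trig_familyE.
Qed.

Lemma trig_family_solution g : solution beta a b g <->
  exists l : R, forall s, U s -> g s = trig_family l s.
Proof.
have c0 : c != 0 by rewrite ck oppr_eq0 expf_neq0.
have init C1 C2 : A C1 C2 0 = C1 by rewrite /A mulr0 cos0 sin0; ring.
split=> [sol|[l gE]].
  have [A' [A1 [A2 [l [hA hA2 gE]]]]] := solution_form beta0 c0 sol.
  have [C1 [C2 AE]] := ode_trig k0 (fun s => proj1 (hA s)) (fun s => proj2 (hA s))
    (fun s => etrans (hA2 s) (congr1 (fun z => z * A' s) ck)).
  have gE' q : U q -> g q = A C1 C2 q.1 + psi_chain beta a b 0 l (disc q).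
    by move=> Uq; rewrite gE// AE.
  have [] := solution_initial (dA C1 C2) (is_derive_psi_chain a b beta0 0 l) gE' sol.
  rewrite !init psi_chain0 => e1 e2; exists l => s Us.
  rewrite gE'// trig_familyE; congr (A _ _ _ + _); first by rewrite -e1 addrK.
  by rewrite -[b]opprK -e2; field.
apply: (regular_solution (dA (1 - l) (- (b / k))) (dA _ _) (dA _ _)
  (is_derive_psi_chain a b beta0 0 l) (is_derive_psi_chain a b beta0 1 l)
  (is_derive_psi_chain a b beta0 2 l)).
- by move=> s Us; rewrite gE// trig_familyE.
- move=> s x x0; rewrite -addrA (psi_chain_ode a b beta0) -/c [RHS]mulrDr.
  by congr (_ + _); rewrite /A ck; ring.
- by rewrite init psi_chain0 subrK.
- by rewrite init; field.
Qed.

End Trigonometric.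

End Families.

(** * The three cases by the sign of [b ^+ 2 - 4 * a] *)

Theorem proposition5p4 (R : realType) (beta : nat) (a b kappa : R)
  (hbeta : beta \in [:: 1; 2; 4]%N) (ha : a != 0)
  (hkappa : kappa = Num.sqrt `|b ^+ 2 - 4 * a|) :
  let nu : R := (beta%:R - 1) / 2 in
  let r (s : R * R) : R := Num.sqrt (s.1 ^+ 2 - 4 * s.2) in
  (* (i) *)
  (b ^+ 2 = 4 * a -> 0 < 4 * a ->
    let G (C : R) (s : R * R) : R :=
      1 - b * s.1 + C * (beta%:R * s.1 ^+ 2 + 4 * s.2) in
    (forall g : R * R -> R, solution beta a b g <->
      exists C : R, forall s, U s -> g s = G C s) /\
    (forall (C : R) (g : R * R -> R), (forall s, U s -> g s = G C s) ->
      forall L : 'M[coefs R beta]_2 -> R, obtained_from a b g L <->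
      given_by g L (fun theta => let s := sigma theta in
        expR (- s.1 / b) / (G C s) `^ (1 / b ^+ 2))))
  /\
  (* (ii) *)
  (b ^+ 2 > 4 * a ->
    let G (C1 C2 C3 : R) (s : R * R) : R :=
      C1 * expR (kappa * s.1) + C2 * expR (- (kappa * s.1))
        + C3 * calI nu (kappa * r s) in
    let G' (lambda : R) (s : R * R) : R :=
      (1 - lambda) * cosh (kappa * s.1) - b / kappa * sinh (kappa * s.1)
        + lambda * calI nu (kappa * r s) in
    let LG (C1 C2 C3 : R) (theta : 'M[coefs R beta]_2) : R :=
      let s := sigma theta in
      expR (- (b * s.1 / (4 * a))) * (G C1 C2 C3 s) `^ (- (1 / (4 * a))) in
    let LG' (lambda : R) (theta : 'M[coefs R beta]_2) : R :=
      let s := sigma theta in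
      expR (- (b * s.1 / (4 * a))) * (G' lambda s) `^ (- (1 / (4 * a))) in
    [/\ forall g : R * R -> R, solution beta a b g <->
          exists C1 C2 C3 : R, [/\ C1 + C2 + C3 = 1, C2 - C1 = b / kappa
            & forall s, U s -> g s = G C1 C2 C3 s],
        forall (C1 C2 C3 : R) (g : R * R -> R),
          C1 + C2 + C3 = 1 -> C2 - C1 = b / kappa ->
          (forall s, U s -> g s = G C1 C2 C3 s) ->
          forall L : 'M[coefs R beta]_2 -> R,
          obtained_from a b g L <-> given_by g L (LG C1 C2 C3),
        forall C1 C2 C3 : R, C1 + C2 + C3 = 1 -> C2 - C1 = b / kappa ->
          exists lambda : R,
          forall theta, hermitian2 theta -> LG C1 C2 C3 theta = LG' lambda theta
      & forall lambda : R,
          exists C1 C2 C3 : R, [/\ C1 + C2 + C3 = 1, C2 - C1 = b / kappa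
          & forall theta, hermitian2 theta ->
              LG' lambda theta = LG C1 C2 C3 theta]])
  /\
  (* (iii) *)
  (b ^+ 2 < 4 * a ->
    let G (lambda : R) (s : R * R) : R :=
      (1 - lambda) * cos (kappa * s.1) - b / kappa * sin (kappa * s.1)
        + lambda * calJ nu (kappa * r s) in
    (forall g : R * R -> R, solution beta a b g <->
      exists lambda : R, forall s, U s -> g s = G lambda s) /\
    (forall (lambda : R) (g : R * R -> R), (forall s, U s -> g s = G lambda s) ->
      forall L : 'M[coefs R beta]_2 -> R, obtained_from a b g L <->
      given_by g L (fun theta => let s := sigma theta in
        expR (- (b * s.1 / (4 * a))) * (G lambda s) `^ (- (1 / (4 * a)))))).
Proof.
move=> nu r.
have beta0 : (0 < beta)%N by move: hbeta; rewrite !inE => /or3P[] /eqP ->.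
have beta1 : (1 : R) <= beta%:R by rewrite ler1n.
have nu0 : 0 <= nu by rewrite divr_ge0// subr_ge0.
have nuE : nu + 1 = (beta%:R + 1) / 2 by rewrite /nu; field.
have kappa0 : 0 <= kappa by rewrite hkappa sqrtr_ge0.
have kappa2 : kappa ^+ 2 = `|b ^+ 2 - 4 * a| by rewrite hkappa sqr_sqrtr.
have r0 s : 0 <= r s by exact: sqrtr_ge0.
have kr0 s : 0 <= kappa * r s by rewrite mulr_ge0.
have r2 s : 0 <= disc s -> r s ^+ 2 = disc s by move=> s0; rewrite sqr_sqrtr.
have Udisc s : U s -> 0 <= disc s by move=> /U_disc/ltW.
have ddisc := @disc_hermitian2 R beta hbeta.
split; last split.
- move=> ba a0 G.
  have c0 : b ^+ 2 - 4 * a = 0 by rewrite ba subrr.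
  split=> [g|C g gE L]; first exact: (poly_family_solution beta0 c0 g).
  apply: obtained_from_given_by => // theta ht /=.
  rewrite (poly_family_extU gE (ddisc _ ht)) ba powRN.
  (* Since [4 * a = b ^+ 2] with [b] nonzero, the exponent [b * s / (4 * a)] simplifies to
     [s / b]. *)
  have b0 : b != 0.
    by apply/eqP => b0; move: ba a0; rewrite b0 expr0n/= => <-; rewrite ltxx.
  by congr (expR _ * _); rewrite -ba; field.
- move=> ba G G' LG LG'.
  have c0 : 0 < b ^+ 2 - 4 * a by rewrite subr_gt0.
  have ck : b ^+ 2 - 4 * a = kappa ^+ 2 by rewrite kappa2 gtr0_norm.
  have k0 : kappa != 0.
    by apply/eqP => k0; move: c0; rewrite ck k0 expr0n/= ltxx.
  (* The square of the Bessel argument [kappa * r s] is [(b ^+ 2 - 4 * a) * disc s], the argument of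
     the entire function. *)
  have GE C1 C2 C3 s : 0 <= disc s ->
      G C1 C2 C3 s = exp_family beta a b kappa C1 C2 C3 s.
    move=> s0; rewrite /G /exp_family /bessel_part (calIE nu0 (kr0 s)).
    by rewrite nuE exprMn r2// -ck.
  (* With [lambda = C3], the constraints turn the hyperbolic part into
     [(C1 + C2) * cosh - (C2 - C1) * sinh], which regroups into the two exponentials. *)
  have LGE : forall (C1 C2 C3 : R) (theta : 'M[coefs R beta]_2),
      C1 + C2 + C3 = 1 -> C2 - C1 = b / kappa ->
      LG C1 C2 C3 theta = LG' C3 theta.
    move=> C1 C2 C3 theta e1 e2; rewrite /LG /LG' /= /G /G' -e2.
    have -> : 1 - C3 = C1 + C2 by rewrite -e1; ring.
    by congr (_ * (_ + _) `^ _); rewrite /cosh /sinh; field.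
  split.
  + move=> g; split.
      move=> /(exp_family_solution beta0 k0 ck)[C1 [C2 [C3 [e1 e2 gE]]]].
      exists C1, C2, C3; split=> // s Us.
      by rewrite gE// GE//; exact: Udisc.
    move=> [C1 [C2 [C3 [e1 e2 gE]]]].
    apply/(exp_family_solution beta0 k0 ck); exists C1, C2, C3; split=> // s Us.
    by rewrite gE// GE//; exact: Udisc.
  + move=> C1 C2 C3 g e1 e2 gE L.
    apply: obtained_from_given_by => // theta ht /=.
    have s0 := ddisc _ ht; rewrite /LG /= (GE _ _ _ _ s0).
    rewrite (@exp_family_extU _ beta a b beta0 kappa C1 C2 C3)// => s Us.
    by rewrite gE// GE//; exact: Udisc.
  + by move=> C1 C2 C3 e1 e2; exists C3 => theta _; exact: LGE.
  (* These constants solve [C1 + C2 = 1 - lambda] and [C2 - C1 = b / kappa]. *)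
  + move=> lambda; exists ((1 - lambda - b / kappa) / 2),
      ((1 - lambda + b / kappa) / 2), lambda.
    have e1 : (1 - lambda - b / kappa) / 2 + (1 - lambda + b / kappa) / 2 + lambda = 1.
      by field.
    have e2 : (1 - lambda + b / kappa) / 2 - (1 - lambda - b / kappa) / 2 = b / kappa.
      by field.
    by split=> // theta _; apply/esym; exact: LGE.
- move=> ba G.
  have c0 : b ^+ 2 - 4 * a < 0 by rewrite subr_lt0.
  have ck : b ^+ 2 - 4 * a = - kappa ^+ 2 by rewrite kappa2 ltr0_norm// opprK.
  have k0 : kappa != 0.
    by apply/eqP => k0; move: c0; rewrite ck k0 expr0n/= oppr0 ltxx.
  have GE l s : 0 <= disc s -> G l s = trig_family beta a b kappa l s.
    move=> s0; rewrite /G /trig_family /bessel_part (calJE nu0 (kr0 s)).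
    by rewrite nuE exprMn r2// ck mulNr.
  split=> [g|l g gE L].
    split=> [/(trig_family_solution beta0 k0 ck)[l gE]|[l gE]].
      by exists l => s Us; rewrite gE// GE//; exact: Udisc.
    apply/(trig_family_solution beta0 k0 ck); exists l => s Us.
    by rewrite gE// GE//; exact: Udisc.
  apply: obtained_from_given_by => // theta ht /=.
  have s0 := ddisc _ ht; rewrite (GE _ _ s0).
  rewrite (@trig_family_extU _ beta a b beta0 kappa l)// => s Us.
  by rewrite gE// GE//; exact: Udisc.
Qed.
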